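(* Let $\mathcal A$ be a unital complex $*$-algebra and let $(\Omega^1_{\mathrm d}(\mathcal A),\dagger,\Psi,\langle\cdot|\cdot\rangle,\sigma)$, $\sigma=\sigma^{\mathrm{can}}$, be a centred Hermitian differential calculus over $\mathcal A$. If $(\overrightarrow\nabla,\sigma)$ is a Hermitian and torsion-free $\sigma$-$\dagger$-bimodule connection on $\Omega^1_{\mathrm d}(\mathcal A)$, with conjugate left connection $\overleftarrow\nabla=-\dagger\circ\overrightarrow\nabla\circ\dagger$, then, with the induced affine connections on vector fields, $(\overleftarrow{\mathcal X}(\mathcal A),\langle\cdot|\cdot\rangle_{\mathcal A},D_\varphi,\overleftarrow\nabla)$ is a right real pseudo-Riemannian calculus and $(\overrightarrow{\mathcal X}(\mathcal A),{}_{\mathcal A}\langle\cdot|\cdot\rangle,D_\varphi,\overrightarrow\nabla)$ is a left real pseudo-Riemannian calculus, and the inner products are strongly non-degenerate.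
   Context: Throughout $\mathcal A$ is a unital complex $*$-algebra. A $\dagger$-bimodule is an $\mathcal A$-bimodule with an antilinear involution $\dagger$ satisfying $(axb)^\dagger=b^*x^\dagger a^*$. **First-order structure.** A Hermitian first-order differential structure over $\mathcal A$ consists of a $\dagger$-bimodule $\Omega=\Omega^1_{\mathrm d}(\mathcal A)$, a $\mathbb C$-linear derivation $\mathrm d:\mathcal A\to\Omega$ with $\mathrm d(a^* )=-\mathrm d(a)^\dagger$, such that every element of $\Omega$ is a finite sum $\sum a_i\,\mathrm d b_i$, $\Omega$ is finitely generated projective as an $\mathcal A$-module, together with a biadditive map $\langle\cdot|\cdot\rangle_{\mathcal A}:\Omega\times\Omega\to\mathcal A$ with: (1) $\langle\omega|\eta a\rangle=\langle\omega|\eta\rangle a$; (2) $\langle\omega|\eta\rangle^*=\langle\eta|\omega\rangle$; (3) $\langle a\omega|\eta\rangle=\langle\omega|a^*\eta\rangle$; (4) $\omega\mapsto(\eta\mapsto\langle\omega^\dagger|\eta\rangle)$ is an isomorphism of left $\mathcal A$-modules from $\Omega$ onto the right-$\mathcal A$-linear maps $\Omega\to\mathcal A$. The left inner product is ${}_{\mathcal A}\langle\omega|\rho\rangle=\langle\omega^\dagger|\rho^\dagger\rangle_{\mathcal A}$. **Centred calculus.** $T^2_{\mathrm d}(\mathcal A)=\Omega\otimes_{\mathcal A}\Omega$ with $(\omega\otimes\eta)^\dagger=\eta^\dagger\otimes\omega^\dagger$. The centre of a bimodule is $\mathcal Z(\mathcal Y)=\{y:ay=ya\ \forall a\}$; $\mathcal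 Y$ is centred if generated as a bimodule by $\mathcal Z(\mathcal Y)$. If $\Omega$ is centred there is a unique invertible bimodule map $\sigma^{\mathrm{can}}$ on $T^2_{\mathrm d}(\mathcal A)$ with $(\sigma^{\mathrm{can}})^{-1}\circ\dagger=\dagger\circ\sigma^{\mathrm{can}}$ and $\sigma^{\mathrm{can}}(\omega\otimes\eta)=\eta\otimes\omega$ whenever $\omega$ or $\eta$ is central; it is an involution. Put $\Psi=\frac12(1+\sigma^{\mathrm{can}})$, $g(\omega\otimes\eta)=-\langle\omega^\dagger|\eta\rangle_{\mathcal A}$, $JT^2_{\mathrm d}=\{\sum\mathrm d a_i\otimes\mathrm d b_i:\sum a_i\,\mathrm d b_i=0\}$. A centred Hermitian differential calculus is a Hermitian first-order differential structure such that $\Omega$ is centred, $g\circ\sigma^{\mathrm{can}}=g$ and $JT^2_{\mathrm d}\subset\operatorname{Im}\Psi$. Its exterior derivative is $\mathrm d_\Psi:\Omega\to T^2_{\mathrm d}(\mathcal A)$, $\mathrm d_\Psi(\sum a_i\,\mathrm d b_i)=(1-\Psi)(\sum\mathrm d a_i\otimes\mathrm d b_i)$. **Connections on forms.** A right connection is a $\mathbb C$-linear $\overrightarrow\nabla:\Omega\to T^2_{\mathrm d}(\mathcal A)$ with $\overrightarrow\nabla(\omega a)=\overrightarrow\nabla(\omega)a+\omega\otimes\mathrm d a$; its conjugate left connection is $\overleftarrow\nabla=-\dagger\circ\overrightarrow\nabla\circ\dagger$. It is torsion-free if $(1-\Psi)\circ\overrightarrow\nabla+\mathrm d_\Psi=0$;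 Hermitian if $-\langle\overrightarrow\nabla\omega|\eta\rangle_\Omega+\langle\omega|\overrightarrow\nabla\eta\rangle_\Omega=\mathrm d\langle\omega|\eta\rangle_{\mathcal A}$, where $\langle\omega|\eta\otimes\rho\rangle_\Omega=\langle\omega|\eta\rangle_{\mathcal A}\rho$, $\langle\eta\otimes\rho|\omega\rangle_\Omega=\rho^\dagger\langle\eta|\omega\rangle_{\mathcal A}$; a $\sigma$-$\dagger$-bimodule connection if $\sigma\circ\overrightarrow\nabla=\overleftarrow\nabla$. **Vector fields.** $\overrightarrow{\mathcal X}(\mathcal A)$, $\overleftarrow{\mathcal X}(\mathcal A)$, $\overleftrightarrow{\mathcal X}(\mathcal A)$ are the right-linear, left-linear and bimodule maps $\Omega\to\mathcal A$. $\overrightarrow{\mathcal X}(\mathcal A)$ is a left module via $(aX)(\omega)=aX(\omega)$ and $\overleftarrow{\mathcal X}(\mathcal A)$ a right module via $(Yb)(\omega)=Y(\omega)b$. For $X\in\overrightarrow{\mathcal X}(\mathcal A)$, $Y\in\overleftarrow{\mathcal X}(\mathcal A)$, write $\langle\langle X|\omega\otimes\eta|Y\rangle\rangle=X(\omega)Y(\eta)$, extended additively to $T^2_{\mathrm d}(\mathcal A)$. The musical isomorphisms are $\overrightarrow\sharp:\Omega\to\overrightarrow{\mathcal X}(\mathcal A)$, $\omega\mapsto(\eta\mapsto\langle\omega^\dagger|\eta\rangle_{\mathcal A})$ and $\overleftarrow\sharp:\Omega\to\overleftarrow{\mathcal X}(\mathcal A)$, $\omega\mapsto(\eta\mapsto\langle\eta^\dagger|\omega\rangle_{\mathcal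 A})$, with inverses $\overrightarrow\flat,\overleftarrow\flat$. Inner products: $\langle X|Y\rangle_{\mathcal A}=\langle X^{\overleftarrow\flat}|Y^{\overleftarrow\flat}\rangle_{\mathcal A}$ on $\overleftarrow{\mathcal X}(\mathcal A)$ and ${}_{\mathcal A}\langle U|V\rangle={}_{\mathcal A}\langle U^{\overrightarrow\flat}|V^{\overrightarrow\flat}\rangle$ on $\overrightarrow{\mathcal X}(\mathcal A)$. Strong non-degeneracy of these means that $X\mapsto\langle X|\cdot\rangle_{\mathcal A}$ is a bijection of $\overleftarrow{\mathcal X}(\mathcal A)$ onto its right-linear dual, respectively $V\mapsto{}_{\mathcal A}\langle\cdot|V\rangle$ is a bijection of $\overrightarrow{\mathcal X}(\mathcal A)$ onto its left-linear dual. **Derivations.** $\mathrm{Der}(\mathcal A)$ is the set of $\mathbb C$-linear derivations of $\mathcal A$; $\partial$ is Hermitian if $\partial(a^* )^*=\partial(a)$ for all $a$. $D_{\mathbb C}=\{\partial\in\mathrm{Der}(\mathcal A):\sum a_i\,\mathrm d b_i=0\Rightarrow\sum a_i\partial b_i=0\}$, $D$ is the set of Hermitian elements of $D_{\mathbb C}$, and $\varphi:D_{\mathbb C}\to\overleftrightarrow{\mathcal X}(\mathcal A)$, $\varphi(\partial)(\sum a_i\,\mathrm d b_i)=\sum a_i\partial b_i$; $D_\varphi=(D,\varphi)$. **Induced affine connections.** For $\partial\in D$: $(\overrightarrow\nabla_\partial X)(\omega)=\partial(X(\omega))-\langle\langle X|\overrightarrow\nabla(\omega)|\varphi(\partial)\rangle\rangle$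 for $X\in\overrightarrow{\mathcal X}(\mathcal A)$, and $(\overleftarrow\nabla_\partial X)(\omega)=\partial(X(\omega))-\langle\langle\varphi(\partial)|\overleftarrow\nabla(\omega)|X\rangle\rangle$ for $X\in\overleftarrow{\mathcal X}(\mathcal A)$. **Calculi.** Data $(\mathcal X,\langle\cdot|\cdot\rangle,\mathfrak g_\varphi,\nabla)$ form a right real pseudo-Riemannian calculus when: $\mathcal X$ is a right $\mathcal A$-module; $\langle\cdot|\cdot\rangle:\mathcal X\times\mathcal X\to\mathcal A$ is biadditive with $\langle X|Ya\rangle=\langle X|Y\rangle a$, $\langle X|Y\rangle^*=\langle Y|X\rangle$, and $\langle X|Y\rangle=0$ for all $Y$ implies $X=0$; $\mathfrak g$ is the real Lie algebra of Hermitian derivations in a complex Lie subalgebra $\mathfrak g_{\mathbb C}\subset\mathrm{Der}(\mathcal A)$, $\varphi:\mathfrak g_{\mathbb C}\to\mathcal X$ is $\mathbb C$-linear, $\mathfrak g_\varphi=(\mathfrak g,\varphi)$; $\varphi(\mathfrak g)$ generates $\mathcal X$ as a right module; $\nabla:\mathfrak g\times\mathcal X\to\mathcal X$ is additive in $X$, real-linear in $\partial$, with $\nabla_\partial(Xa)=(\nabla_\partial X)a+X\partial a$; for $X,Y\in\varphi(\mathfrak g)$ and $\partial,\partial_1,\partial_2\in\mathfrak g$ the elements $\langle X|Y\rangle$, $\langle\nabla_\partial X|Y\rangle$, $\langle\nabla_{\partial_1}\nabla_{\partial_2}X|Y\rangle$ are self-adjoint; $\partial\langle X|Y\rangle=\langle\nabla_\partial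 X|Y\rangle+\langle X|\nabla_\partial Y\rangle$ for all $X,Y\in\mathcal X$; and $\nabla_{\partial_1}\varphi(\partial_2)-\nabla_{\partial_2}\varphi(\partial_1)-\varphi([\partial_1,\partial_2])=0$. Left real pseudo-Riemannian calculi are defined analogously for left modules with ${}_{\mathcal A}\langle aX|Y\rangle=a\,{}_{\mathcal A}\langle X|Y\rangle$ and $\nabla_\partial(aX)=a\nabla_\partial X+(\partial a)X$. Here $\mathfrak g_{\mathbb C}=D_{\mathbb C}$, $\mathfrak g=D$. *)

(* Defs.v *)
From HB Require Import structures.
From mathcomp Require Import all_boot all_order all_algebra.
From mathcomp Require Import complex.
From mathcomp Require Import boolp classical_sets functions reals.

Set Implicit Arguments.
Unset Strict Implicit.
Unset Printing Implicit Defensive.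

Import Order.TTheory GRing.Theory Num.Theory.
Local Open Scope ring_scope.
Local Open Scope quotient_scope.
Local Open Scope complex_scope.

(* The complex numbers are R[i] for a model R of the real numbers. *)
HB.mixin Record isStarAlgebra (R : realType) A of GRing.Algebra R[i] A := {
  star : A -> A;
  starD : forall a b, star (a + b) = star a + star b;
  starZ : forall (c : R[i]) a, star (c *: a) = c^* *: star a;
  starM : forall a b, star (a * b) = star b * star a;
  starK : involutive star
}.

#[short(type="starAlgType")]
HB.structure Definition StarAlgebra (R : realType) :=
  {A of GRing.Algebra R[i] A & isStarAlgebra R A}.

(* [cscal A c] is the element c 1 of A; the complex vector space structure of a
   module over A is given by the action of these elements. *)
Definition cscal (R : realType) (A : starAlgType R) (c : R[i]) : A := c%:A.

HB.mixin Record Zmodule_isRightModule (R : realType) (A : starAlgType R) M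
    of GRing.Zmodule M := {
  rscale : M -> A -> M;
  rscaleA : forall x a b, rscale (rscale x a) b = rscale x (a * b);
  rscaler1 : forall x, rscale x 1 = x;
  rscalerDl : forall x y a, rscale (x + y) a = rscale x a + rscale y a;
  rscalerDr : forall x a b, rscale x (a + b) = rscale x a + rscale x b
}.

#[short(type="rmodType")]
HB.structure Definition RightModule (R : realType) (A : starAlgType R) :=
  {M of GRing.Zmodule M & Zmodule_isRightModule R A M}.

Notation "x :* a" := (rscale x a) : ring_scope.

HB.mixin Record isBimodule (R : realType) (A : starAlgType R) M
    of GRing.Lmodule A M & RightModule R A M := {
  bimodA : forall (a : A) (x : M) (b : A), (a *: x) :* b = a *: (x :* b);
  bimodC : forall (c : R[i]) (x : M), cscal A c *: x = x :* cscal A c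
}.

#[short(type="bimodType")]
HB.structure Definition Bimodule (R : realType) (A : starAlgType R) :=
  {M of GRing.Lmodule A M & RightModule R A M & isBimodule R A M}.

HB.mixin Record isDagBimodule (R : realType) (A : starAlgType R) M
    of Bimodule R A M := {
  dag : M -> M;
  dagD : forall x y, dag (x + y) = dag x + dag y;
  dagZ : forall (c : R[i]) x, dag (cscal A c *: x) = cscal A c^* *: dag x;
  dagK : involutive dag;
  dagM : forall (a : A) x (b : A), dag (a *: x :* b) = star b *: dag x :* star a
}.

#[short(type="dagBimodType")]
HB.structure Definition DagBimodule (R : realType) (A : starAlgType R) :=
  {M of Bimodule R A M & isDagBimodule R A M}.

Lemma star1 (R : realType) (A : starAlgType R) : star (1 : A) = 1.
Proof.
have h : star (1 : A) = star 1 * 1 by rewrite mulr1.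
by rewrite h -{2}(starK 1) -starM mulr1 starK.
Qed.

Lemma star_cscal (R : realType) (A : starAlgType R) (c : R[i]) :
  star (cscal A c) = cscal A c^*.
Proof. by rewrite /cscal starZ star1. Qed.

Lemma dagMl (R : realType) (A : starAlgType R) (M : dagBimodType A) (a : A)
  (x : M) : dag (a *: x) = dag x :* star a.
Proof. by rewrite -[a *: x]rscaler1 dagM star1 scale1r. Qed.

Lemma dagMr (R : realType) (A : starAlgType R) (M : dagBimodType A) (x : M)
  (a : A) : dag (x :* a) = star a *: dag x.
Proof. by rewrite -[x]scale1r dagM star1 rscaler1 scale1r. Qed.

(* The tensor square over A.  Its elements are represented by lists of pairs,
   read as formal sums of pure tensors, and two of them are identified when no
   balanced biadditive map distinguishes them. *)
Section TensorSquare.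
Context (R : realType) (A : starAlgType R) (M : dagBimodType A).

Definition balanced (V : zmodType) (f : M -> M -> V) : Prop :=
  [/\ forall x x' y, f (x + x') y = f x y + f x' y,
      forall x y y', f x (y + y') = f x y + f x y' &
      forall x a y, f (x :* a) y = f x (a *: y)].

Definition tens_eqv (s t : seq (M * M)) : Prop :=
  forall (V : zmodType) (f : M -> M -> V), balanced f ->
    \sum_(p <- s) f p.1 p.2 = \sum_(p <- t) f p.1 p.2.

Definition tens_rel : rel (seq (M * M)) := fun s t => `[< tens_eqv s t >].

Lemma tens_rel_refl : reflexive tens_rel.
Proof. by move=> s; apply/asboolP. Qed.

Lemma tens_rel_sym : symmetric tens_rel.
Proof.
by move=> s t; apply/asboolP/asboolP => h V f bf; rewrite h.
Qed.

Lemma tens_rel_trans : transitive tens_rel.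
Proof.
by move=> t s u /asboolP h1 /asboolP h2; apply/asboolP => V f bf; rewrite h1 ?h2.
Qed.

Canonical tens_equiv :=
  EquivRel tens_rel tens_rel_refl tens_rel_sym tens_rel_trans.

Definition tensor2 := {eq_quot tens_equiv}.

HB.instance Definition _ := Choice.on tensor2.
HB.instance Definition _ := EqQuotient.on tensor2.

Definition tens (x y : M) : tensor2 := \pi_tensor2 [:: (x, y)].

(* The additive extension of f to the tensor square; meaningful when f is
   balanced. *)
Definition tlift (V : zmodType) (f : M -> M -> V) (t : tensor2) : V :=
  \sum_(p <- repr t) f p.1 p.2.

Lemma tlift_pi (V : zmodType) (f : M -> M -> V) s : balanced f ->
  tlift f (\pi_tensor2 s) = \sum_(p <- s) f p.1 p.2.
Proof.
move=> bf; rewrite /tlift; case: piP => s' /eqmodP /asboolP h.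
by rewrite (h V f bf).
Qed.

Lemma tliftE (V : zmodType) (f : M -> M -> V) x y : balanced f ->
  tlift f (tens x y) = f x y.
Proof. by move=> bf; rewrite tlift_pi// big_seq1. Qed.

Lemma tensor2_ext (t u : tensor2) :
  (forall (V : zmodType) (f : M -> M -> V), balanced f -> tlift f t = tlift f u) ->
  t = u.
Proof.
move=> h; rewrite -[t]reprK -[u]reprK; apply/eqmodP/asboolP => V f bf.
exact: (h V f bf).
Qed.

Definition tens_add (t u : tensor2) := \pi_tensor2 (repr t ++ repr u).
Definition tens_opp (t : tensor2) :=
  \pi_tensor2 [seq (- p.1, p.2) | p <- repr t].
Definition tens_lscale (a : A) (t : tensor2) :=
  \pi_tensor2 [seq (a *: p.1, p.2) | p <- repr t].
Definition tens_rscale (t : tensor2) (a : A) :=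
  \pi_tensor2 [seq (p.1, p.2 :* a) | p <- repr t].
Definition tens_dag (t : tensor2) :=
  \pi_tensor2 [seq (dag p.2, dag p.1) | p <- repr t].

Lemma balancedNl (V : zmodType) (f : M -> M -> V) : balanced f ->
  forall x y, f (- x) y = - f x y.
Proof.
case=> fl fr fb x y; apply/eqP; rewrite -addr_eq0 -fl addNr.
by apply/eqP; apply: (@addrI _ (f 0 y)); rewrite -fl !addr0.
Qed.

Lemma tlift_add (V : zmodType) (f : M -> M -> V) t u : balanced f ->
  tlift f (tens_add t u) = tlift f t + tlift f u.
Proof. by move=> bf; rewrite tlift_pi// big_cat. Qed.

Lemma tlift_opp (V : zmodType) (f : M -> M -> V) t : balanced f ->
  tlift f (tens_opp t) = - tlift f t.
Proof.
move=> bf; rewrite tlift_pi// big_map -sumrN.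
by apply: eq_bigr => p _; rewrite balancedNl.
Qed.

Lemma tlift_zero (V : zmodType) (f : M -> M -> V) : balanced f ->
  tlift f (\pi_tensor2 [::]) = 0.
Proof. by move=> bf; rewrite tlift_pi// big_nil. Qed.

Lemma tens_addA : associative tens_add.
Proof. by move=> t u v; apply: tensor2_ext => V f bf; rewrite !tlift_add ?addrA. Qed.
Lemma tens_addC : commutative tens_add.
Proof. by move=> t u; apply: tensor2_ext => V f bf; rewrite !tlift_add// addrC. Qed.
Lemma tens_add0 : left_id (\pi_tensor2 [::]) tens_add.
Proof.
by move=> t; apply: tensor2_ext => V f bf; rewrite tlift_add// tlift_zero// add0r.
Qed.
Lemma tens_addN : left_inverse (\pi_tensor2 [::]) tens_opp tens_add.
Proof.
move=> t; apply: tensor2_ext => V f bf.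
by rewrite tlift_add// tlift_opp// tlift_zero// addNr.
Qed.

HB.instance Definition _ := GRing.isZmodule.Build tensor2
  tens_addA tens_addC tens_add0 tens_addN.

Lemma tliftD (V : zmodType) (f : M -> M -> V) t u : balanced f ->
  tlift f (t + u) = tlift f t + tlift f u.
Proof. exact: tlift_add. Qed.

Lemma balanced_lscale (V : zmodType) (f : M -> M -> V) a : balanced f ->
  balanced (fun x y => f (a *: x) y).
Proof.
case=> fl fr fb; split=> *; rewrite ?scalerDr ?fl ?fr//.
by rewrite -bimodA fb.
Qed.

Lemma balanced_rscale (V : zmodType) (f : M -> M -> V) a : balanced f ->
  balanced (fun x y => f x (y :* a)).
Proof.
case=> fl fr fb; split=> *; rewrite ?rscalerDl ?fl ?fr//.
by rewrite bimodA fb.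
Qed.

Lemma balanced_dag (V : zmodType) (f : M -> M -> V) : balanced f ->
  balanced (fun x y => f (dag y) (dag x)).
Proof.
case=> fl fr fb; split=> *; rewrite ?dagD ?fl ?fr//.
by rewrite dagMr dagMl fb.
Qed.

Lemma tlift_lscale (V : zmodType) (f : M -> M -> V) a t : balanced f ->
  tlift f (tens_lscale a t) = tlift (fun x y => f (a *: x) y) t.
Proof. by move=> bf; rewrite tlift_pi// big_map. Qed.

Lemma tlift_rscale (V : zmodType) (f : M -> M -> V) a t : balanced f ->
  tlift f (tens_rscale t a) = tlift (fun x y => f x (y :* a)) t.
Proof. by move=> bf; rewrite tlift_pi// big_map. Qed.

Lemma tlift_dag (V : zmodType) (f : M -> M -> V) t : balanced f ->
  tlift f (tens_dag t) = tlift (fun x y => f (dag y) (dag x)) t.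
Proof. by move=> bf; rewrite tlift_pi// big_map. Qed.

Lemma eq_tlift (V : zmodType) (f g : M -> M -> V) t :
  (forall x y, f x y = g x y) -> tlift f t = tlift g t.
Proof. by move=> fg; apply: eq_bigr => p _; apply: fg. Qed.

Lemma tens_lscaleA a b t :
  tens_lscale a (tens_lscale b t) = tens_lscale (a * b) t.
Proof.
apply: tensor2_ext => V f bf; rewrite !tlift_lscale//; last exact: balanced_lscale.
by apply: eq_tlift => x y; rewrite scalerA.
Qed.
Lemma tens_lscale1 : left_id 1 tens_lscale.
Proof.
move=> t; apply: tensor2_ext => V f bf; rewrite tlift_lscale//.
by apply: eq_tlift => x y; rewrite scale1r.
Qed.
Lemma tens_lscaleDr : right_distributive tens_lscale +%R.
Proof.
move=> a t u; apply: tensor2_ext => V f bf.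
by rewrite tliftD// !tlift_lscale// tliftD//; exact: balanced_lscale.
Qed.
Lemma tens_lscaleDl t : {morph tens_lscale^~ t : a b / a + b}.
Proof.
move=> a b; apply: tensor2_ext => V f bf.
rewrite tliftD// !tlift_lscale// -big_split/=.
by apply: eq_bigr => p _; case: bf => fl _ _; rewrite scalerDl fl.
Qed.

HB.instance Definition _ := GRing.Zmodule_isLmodule.Build A tensor2
  tens_lscaleA tens_lscale1 tens_lscaleDr tens_lscaleDl.

Lemma tens_rscaleA t a b :
  tens_rscale (tens_rscale t a) b = tens_rscale t (a * b).
Proof.
apply: tensor2_ext => V f bf; rewrite !tlift_rscale//; last exact: balanced_rscale.
by apply: eq_tlift => x y; rewrite rscaleA.
Qed.
Lemma tens_rscale1 t : tens_rscale t 1 = t.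
Proof.
apply: tensor2_ext => V f bf; rewrite tlift_rscale//.
by apply: eq_tlift => x y; rewrite rscaler1.
Qed.
Lemma tens_rscaleDl t u a :
  tens_rscale (t + u) a = tens_rscale t a + tens_rscale u a.
Proof.
apply: tensor2_ext => V f bf.
by rewrite tliftD// !tlift_rscale// tliftD//; exact: balanced_rscale.
Qed.
Lemma tens_rscaleDr t a b :
  tens_rscale t (a + b) = tens_rscale t a + tens_rscale t b.
Proof.
apply: tensor2_ext => V f bf.
rewrite tliftD// !tlift_rscale// -big_split/=.
by apply: eq_bigr => p _; case: bf => _ fr _; rewrite rscalerDr fr.
Qed.

HB.instance Definition _ := Zmodule_isRightModule.Build R A tensor2
  tens_rscaleA tens_rscale1 tens_rscaleDl tens_rscaleDr.

Lemma tens_bimodA (a : A) (t : tensor2) (b : A) : (a *: t) :* b = a *: (t :* b).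
Proof.
apply: tensor2_ext => V f bf.
rewrite tlift_rscale// tlift_lscale//; last exact: balanced_rscale.
by rewrite tlift_lscale// tlift_rscale//; exact: balanced_lscale.
Qed.

Lemma tens_bimodC (c : R[i]) (t : tensor2) : cscal A c *: t = t :* cscal A c.
Proof.
apply: tensor2_ext => V f bf; rewrite tlift_lscale// tlift_rscale//.
by apply: eq_tlift => x y; rewrite bimodC; case: bf => _ _ fb;
   rewrite fb bimodC.
Qed.

HB.instance Definition _ := isBimodule.Build R A tensor2 tens_bimodA tens_bimodC.

Lemma tens_dagD (t u : tensor2) : tens_dag (t + u) = tens_dag t + tens_dag u.
Proof.
apply: tensor2_ext => V f bf.
by rewrite tliftD// !tlift_dag// tliftD//; exact: balanced_dag.
Qed.

Lemma tens_dagK : involutive tens_dag.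
Proof.
move=> t; apply: tensor2_ext => V f bf.
rewrite !tlift_dag//; last exact: balanced_dag.
by apply: eq_tlift => x y; rewrite !dagK.
Qed.

Lemma tens_dagM (a : A) (t : tensor2) (b : A) :
  tens_dag (a *: t :* b) = star b *: tens_dag t :* star a.
Proof.
apply: tensor2_ext => V f bf.
have bd := balanced_dag bf; have br := balanced_rscale b bd.
have bl := balanced_lscale (star b) bf; have br' := balanced_rscale (star a) bf.
have bl' := balanced_lscale (star b) br'.
rewrite tlift_dag// tlift_rscale// tlift_lscale//.
rewrite tlift_rscale// tlift_lscale// tlift_dag//.
by apply: eq_tlift => x y; rewrite dagMl dagMr.
Qed.

Lemma tens_dagZ (c : R[i]) (t : tensor2) :
  tens_dag (cscal A c *: t) = cscal A c^* *: tens_dag t.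
Proof.
rewrite -[cscal A c *: t]rscaler1 tens_dagM star1 scale1r star_cscal.
by rewrite bimodC.
Qed.

HB.instance Definition _ :=
  isDagBimodule.Build R A tensor2 tens_dagD tens_dagZ tens_dagK tens_dagM.

Lemma balanced_tens : balanced tens.
Proof.
split=> [x x' y|x y y'|x a y]; apply: tensor2_ext => V f bf; rewrite ?tliftD//;
  by rewrite !tliftE//; case: bf.
Qed.

Lemma tens_sumE (t : tensor2) : exists s : seq (M * M),
  t = \sum_(p <- s) tens p.1 p.2.
Proof.
exists (repr t); apply: tensor2_ext => V f bf.
have e0 : tlift f 0 = 0 by exact: tlift_zero.
rewrite (big_morph (tlift f) (fun t u => tliftD t u bf) e0).
by apply: eq_bigr => p _; rewrite tliftE.
Qed.

Lemma lscale_tens a x y : a *: tens x y = tens (a *: x) y.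
Proof.
by apply: tensor2_ext => V f bf; rewrite tlift_lscale// !tliftE//;
   exact: balanced_lscale.
Qed.

Lemma rscale_tens x y a : tens x y :* a = tens x (y :* a).
Proof.
by apply: tensor2_ext => V f bf; rewrite tlift_rscale// !tliftE//;
   exact: balanced_rscale.
Qed.

Lemma dag_tens x y : dag (tens x y) = tens (dag y) (dag x).
Proof.
by apply: tensor2_ext => V f bf; rewrite tlift_dag// !tliftE//;
   exact: balanced_dag.
Qed.

End TensorSquare.

Section ModuleNotions.
Context (R : realType) (A : starAlgType R).

Definition llinear (M : lmodType A) (f : M -> A) : Prop :=
  (forall x y, f (x + y) = f x + f y) /\ (forall a x, f (a *: x) = a * f x).

Definition rlinear (M : rmodType A) (f : M -> A) : Prop :=
  (forall x y, f (x + y) = f x + f y) /\ (forall x a, f (x :* a) = f x * a).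

Definition bimodule_map (M N : bimodType A) (f : M -> N) : Prop :=
  [/\ forall x y, f (x + y) = f x + f y,
      forall a x, f (a *: x) = a *: f x &
      forall x a, f (x :* a) = f x :* a].

Definition central (M : bimodType A) (z : M) : Prop :=
  forall a : A, a *: z = z :* a.

Definition centred (M : bimodType A) : Prop :=
  forall x : M, exists s : seq (A * M * A),
    (forall p, p \in s -> central p.1.2) /\
    x = \sum_(p <- s) p.1.1 *: p.1.2 :* p.2.

Definition finitely_generated (M : lmodType A) : Prop :=
  exists (n : nat) (e : 'I_n -> M),
    forall x, exists c : 'I_n -> A, x = \sum_(i < n) c i *: e i.

Definition projective (M : lmodType A) : Prop :=
  forall (P N : lmodType A) (p : {linear P -> N}) (f : {linear M -> N}),
    (forall y, exists x, p x = y) ->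
    exists h : {linear M -> P}, forall x, p (h x) = f x.

End ModuleNotions.

(* The left (resp. right) vector fields, when M is the bimodule of one-forms,
   are the left-linear (resp. right-linear) maps from M to A: they form a right
   (resp. left) module. *)
Section LeftVectorFields.
Context (R : realType) (A : starAlgType R) (M : lmodType A).

Definition llin_pred : {pred M -> A} := fun f => `[< llinear f >].

Lemma llin_pred_zmod : zmod_closed llin_pred.
Proof.
split; first by apply/asboolP; split=> *; rewrite ?addr0 ?mulr0.
move=> f g /asboolP [fD fZ] /asboolP [gD gZ]; apply/asboolP; split=> [x y|a x].
  by rewrite !fctE fD gD opprD addrACA.
by rewrite !fctE fZ gZ mulrBr.
Qed.

HB.instance Definition _ := GRing.isZmodClosed.Build (M -> A) llin_pred
  llin_pred_zmod.

Record lvfield := LVField { lvfield_fun :> M -> A; lvfieldP : lvfield_fun \in llin_pred }.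

HB.instance Definition _ := [isSub for lvfield_fun].
HB.instance Definition _ := [Choice of lvfield by <:].
HB.instance Definition _ := [SubChoice_isSubZmodule of lvfield by <:].

Definition mk_lvfield (f : M -> A) (fl : llinear f) : lvfield := LVField (asboolT fl).

Lemma lvfield_linear (X : lvfield) : llinear X.
Proof. exact: (asboolW (lvfieldP X)). Qed.

Lemma lvfield_eq (X Y : lvfield) : (forall x, X x = Y x) -> X = Y.
Proof. by move=> h; apply: val_inj; apply: funext => x; apply: h. Qed.

Lemma lvfieldDE (X Y : lvfield) x : (X + Y) x = X x + Y x.
Proof. by []. Qed.

Lemma lvfield_rscale_subproof (X : lvfield) (b : A) : llinear (fun x => X x * b).
Proof.
by have [XD XZ] := lvfield_linear X; split=> *; rewrite ?XD ?XZ ?mulrDl ?mulrA.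
Qed.

Definition lvfield_rscale X b : lvfield := mk_lvfield (lvfield_rscale_subproof X b).

Lemma lvfield_rscaleA X a b :
  lvfield_rscale (lvfield_rscale X a) b = lvfield_rscale X (a * b).
Proof. by apply: lvfield_eq => x /=; rewrite mulrA. Qed.
Lemma lvfield_rscale1 X : lvfield_rscale X 1 = X.
Proof. by apply: lvfield_eq => x /=; rewrite mulr1. Qed.
Lemma lvfield_rscaleDl X Y a :
  lvfield_rscale (X + Y) a = lvfield_rscale X a + lvfield_rscale Y a.
Proof. by apply: lvfield_eq => x; rewrite lvfieldDE /= mulrDl. Qed.
Lemma lvfield_rscaleDr X a b :
  lvfield_rscale X (a + b) = lvfield_rscale X a + lvfield_rscale X b.
Proof. by apply: lvfield_eq => x; rewrite lvfieldDE /= mulrDr. Qed.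

HB.instance Definition _ := Zmodule_isRightModule.Build R A lvfield
  lvfield_rscaleA lvfield_rscale1 lvfield_rscaleDl lvfield_rscaleDr.

Lemma lvfield_rscaleE (X : lvfield) (b : A) x : (X :* b) x = X x * b.
Proof. by []. Qed.

End LeftVectorFields.

Section RightVectorFields.
Context (R : realType) (A : starAlgType R) (M : rmodType A).

Definition rlin_pred : {pred M -> A} := fun f => `[< rlinear f >].

Lemma rlin_pred_zmod : zmod_closed rlin_pred.
Proof.
split; first by apply/asboolP; split=> *; rewrite ?addr0 ?mul0r.
move=> f g /asboolP [fD fZ] /asboolP [gD gZ]; apply/asboolP; split=> [x y|x a].
  by rewrite !fctE fD gD opprD addrACA.
by rewrite !fctE fZ gZ mulrBl.
Qed.

HB.instance Definition _ := GRing.isZmodClosed.Build (M -> A) rlin_pred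
  rlin_pred_zmod.

Record rvfield := RVField { rvfield_fun :> M -> A; rvfieldP : rvfield_fun \in rlin_pred }.

HB.instance Definition _ := [isSub for rvfield_fun].
HB.instance Definition _ := [Choice of rvfield by <:].
HB.instance Definition _ := [SubChoice_isSubZmodule of rvfield by <:].

Definition mk_rvfield (f : M -> A) (fl : rlinear f) : rvfield := RVField (asboolT fl).

Lemma rvfield_linear (X : rvfield) : rlinear X.
Proof. exact: (asboolW (rvfieldP X)). Qed.

Lemma rvfield_eq (X Y : rvfield) : (forall x, X x = Y x) -> X = Y.
Proof. by move=> h; apply: val_inj; apply: funext => x; apply: h. Qed.

Lemma rvfieldDE (X Y : rvfield) x : (X + Y) x = X x + Y x.
Proof. by []. Qed.

Lemma rvfield_lscale_subproof (a : A) (X : rvfield) : rlinear (fun x => a * X x).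
Proof.
by have [XD XZ] := rvfield_linear X; split=> *; rewrite ?XD ?XZ ?mulrDr ?mulrA.
Qed.

Definition rvfield_lscale a X : rvfield := mk_rvfield (rvfield_lscale_subproof a X).

Lemma rvfield_lscaleA a b X :
  rvfield_lscale a (rvfield_lscale b X) = rvfield_lscale (a * b) X.
Proof. by apply: rvfield_eq => x /=; rewrite mulrA. Qed.
Lemma rvfield_lscale1 : left_id 1 rvfield_lscale.
Proof. by move=> X; apply: rvfield_eq => x /=; rewrite mul1r. Qed.
Lemma rvfield_lscaleDr : right_distributive rvfield_lscale +%R.
Proof. by move=> a X Y; apply: rvfield_eq => x; rewrite rvfieldDE /= mulrDr. Qed.
Lemma rvfield_lscaleDl X : {morph rvfield_lscale^~ X : a b / a + b}.
Proof. by move=> a b; apply: rvfield_eq => x; rewrite rvfieldDE /= mulrDl. Qed.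

HB.instance Definition _ := GRing.Zmodule_isLmodule.Build A rvfield
  rvfield_lscaleA rvfield_lscale1 rvfield_lscaleDr rvfield_lscaleDl.

Lemma rvfield_lscaleE (a : A) (X : rvfield) x : (a *: X) x = a * X x.
Proof. by []. Qed.

End RightVectorFields.

Section BimoduleVectorFields.
Context (R : realType) (A : starAlgType R) (M : bimodType A).

Record bvfield := BVField {
  bvfield_fun :> M -> A;
  bvfield_llinear : llinear bvfield_fun;
  bvfield_rlinear : rlinear bvfield_fun
}.

Definition lvfield_of (X : bvfield) : lvfield M := mk_lvfield (bvfield_llinear X).
Definition rvfield_of (X : bvfield) : rvfield M := mk_rvfield (bvfield_rlinear X).

End BimoduleVectorFields.

Section Derivations.
Context (R : realType) (A : starAlgType R).

Definition derivation (D : A -> A) : Prop :=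
  (forall (c : R[i]) a b, D (c *: a + b) = c *: D a + D b) /\
  (forall a b, D (a * b) = D a * b + a * D b).

Definition hermitian_der (D : A -> A) : Prop :=
  forall a, star (D (star a)) = D a.

Definition lie_bracket (D1 D2 : A -> A) : A -> A :=
  fun a => D1 (D2 a) - D2 (D1 a).

Definition lie_subalgebra (g : (A -> A) -> Prop) : Prop :=
  [/\ forall D, g D -> derivation D,
      g (fun=> 0),
      forall (c : R[i]) D1 D2, g D1 -> g D2 -> g (fun a => c *: D1 a + D2 a) &
      forall D1 D2, g D1 -> g D2 -> g (lie_bracket D1 D2)].

(* For g a set of derivations, [der_of g] and [hder_of g] are the types of its
   elements and of its Hermitian elements. *)
Record der_of (g : (A -> A) -> Prop) :=
  DerOf { der_fun :> A -> A; der_mem : g der_fun }.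

Record hder_of (g : (A -> A) -> Prop) :=
  HDerOf { hder_der :> der_of g; hder_herm : hermitian_der hder_der }.

End Derivations.

Section FirstOrder.
Context (R : realType) (A : starAlgType R).

(* Because of dag, being finitely generated projective as a left or as a right
   module is the same.  The three fields [ip_sharp_*] say that
   w |-> <dag w | .> is an isomorphism of left modules from Omega onto the
   right-linear maps Omega -> A. *)
Record hermFOStructure (Omega : dagBimodType A) := HermFOStructure {
  dd : A -> Omega;
  ip : Omega -> Omega -> A;
  dd_linear : forall (c : R[i]) a b, dd (c *: a + b) = cscal A c *: dd a + dd b;
  dd_leibniz : forall a b, dd (a * b) = dd a :* b + a *: dd b;
  dd_star : forall a, dd (star a) = - dag (dd a);
  dd_gen : forall w, exists s : seq (A * A), w = \sum_(p <- s) p.1 *: dd p.2;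
  fo_finitely_generated : finitely_generated Omega;
  fo_projective : projective Omega;
  ipDl : forall w w' h, ip (w + w') h = ip w h + ip w' h;
  ipDr : forall w h h', ip w (h + h') = ip w h + ip w h';
  ipMr : forall w h a, ip w (h :* a) = ip w h * a;
  ip_star : forall w h, star (ip w h) = ip h w;
  ipMl : forall a w h, ip (a *: w) h = ip w (star a *: h);
  ip_sharp_scale : forall a w h, ip (dag (a *: w)) h = a * ip (dag w) h;
  ip_sharp_inj : forall w w',
    (forall h, ip (dag w) h = ip (dag w') h) -> w = w';
  ip_sharp_surj : forall f : Omega -> A, rlinear f ->
    exists w, forall h, ip (dag w) h = f h
}.

Context (Omega : dagBimodType A) (K : hermFOStructure Omega).
Local Notation d := (dd K).
Local Notation "<| x , y |>" := (ip K x y).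
Local Notation T2 := (tensor2 Omega).

Lemma ipZr w a h : <| w :* a, h |> = star a * <| w, h |>.
Proof. by rewrite -ip_star ipMr starM ip_star. Qed.

Lemma sharpR_subproof w : rlinear (fun h => <| dag w, h |>).
Proof. by split=> *; rewrite ?ipDr ?ipMr. Qed.

Lemma sharpL_subproof w : llinear (fun h => <| dag h, w |>).
Proof. by split=> [x y|a x]; rewrite ?dagD ?ipDl// dagMl ipZr starK. Qed.

Definition sharpR (w : Omega) : rvfield Omega := mk_rvfield (sharpR_subproof w).
Definition sharpL (w : Omega) : lvfield Omega := mk_lvfield (sharpL_subproof w).

Lemma sharpR_inj : injective sharpR.
Proof.
move=> w w' e; apply: (@ip_sharp_inj _ K) => h.
by have := congr1 (fun X : rvfield _ => X h) e.
Qed.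

Lemma sharpR_surj (X : rvfield Omega) : exists w, sharpR w = X.
Proof.
have [w hw] := @ip_sharp_surj _ K X (rvfield_linear X).
by exists w; apply: rvfield_eq => h; apply: hw.
Qed.

Lemma sharpL_inj : injective sharpL.
Proof.
move=> w w' e; apply: (can_inj dagK); apply: (@ip_sharp_inj _ K) => h.
have := congr1 (fun X : lvfield _ => X (dag h)) e => /= /(congr1 star).
by rewrite !ip_star !dagK.
Qed.

Lemma sharpL_surj (X : lvfield Omega) : exists w, sharpL w = X.
Proof.
have [XD XZ] := lvfield_linear X.
have Xl : rlinear (fun h => star (X (dag h))).
  by split=> [x y|x a]; rewrite ?dagD ?XD ?starD// dagMr XZ starM starK.
have [w hw] := @ip_sharp_surj _ K _ Xl.
exists (dag w); apply: lvfield_eq => h /=.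
by rewrite -ip_star hw starK dagK.
Qed.

Definition flatR (X : rvfield Omega) : Omega := sval (cid (sharpR_surj X)).
Definition flatL (X : lvfield Omega) : Omega := sval (cid (sharpL_surj X)).

Lemma flatRK : cancel flatR sharpR.
Proof. by move=> X; rewrite /flatR; case: cid. Qed.
Lemma flatLK : cancel flatL sharpL.
Proof. by move=> X; rewrite /flatL; case: cid. Qed.
Lemma sharpRK : cancel sharpR flatR.
Proof. by move=> w; apply: sharpR_inj; rewrite flatRK. Qed.
Lemma sharpLK : cancel sharpL flatL.
Proof. by move=> w; apply: sharpL_inj; rewrite flatLK. Qed.

Definition ip_lvf (X Y : lvfield Omega) : A := <| flatL X, flatL Y |>.
Definition ip_rvf (U V : rvfield Omega) : A :=
  <| dag (flatR U), dag (flatR V) |>.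

(* A chosen expression of w as a sum of terms a db. *)
Definition form_rep (w : Omega) : seq (A * A) := sval (cid (dd_gen K w)).

Lemma form_repP w : w = \sum_(p <- form_rep w) p.1 *: d p.2.
Proof. by rewrite /form_rep; case: cid. Qed.

Definition metric_g (t : T2) : A := tlift (fun w h => - <| dag w, h |>) t.

Definition pairing (X : rvfield Omega) (t : T2) (Y : lvfield Omega) : A :=
  tlift (fun w h => X w * Y h) t.

Definition ip_form_tens (w : Omega) (t : T2) : Omega :=
  tlift (fun h r => <| w, h |> *: r) t.

Definition ip_tens_form (t : T2) (w : Omega) : Omega :=
  tlift (fun h r => dag r :* <| h, w |>) t.

Lemma balanced_metric_g : balanced (fun w h : Omega => - <| dag w, h |>).
Proof.
split=> *; rewrite ?dagD ?ipDl ?ipDr ?opprD//.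
by rewrite dagMr ipMl starK.
Qed.

Lemma balanced_pairing (X : rvfield Omega) (Y : lvfield Omega) :
  balanced (fun w h => X w * Y h).
Proof.
have [XD XZ] := rvfield_linear X; have [YD YZ] := lvfield_linear Y.
by split=> *; rewrite ?XD ?YD ?mulrDl ?mulrDr// XZ YZ mulrA.
Qed.

Lemma balanced_ip_form_tens w : balanced (fun h r : Omega => <| w, h |> *: r).
Proof.
by split=> *; rewrite ?ipDr ?scalerDl ?scalerDr// ipMr scalerA.
Qed.

Lemma balanced_ip_tens_form w :
  balanced (fun h r : Omega => dag r :* <| h, w |>).
Proof.
by split=> *; rewrite ?dagD ?ipDl ?rscalerDl ?rscalerDr// ipZr dagMl rscaleA.
Qed.

Definition lift_derivation (D : A -> A) : Prop :=
  derivation D /\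
  forall s : seq (A * A),
    \sum_(p <- s) p.1 *: d p.2 = 0 -> \sum_(p <- s) p.1 * D p.2 = 0.

(* Independent of the expression chosen for w, see [phi_funE]. *)
Definition phi_fun (D : der_of lift_derivation) (w : Omega) : A :=
  \sum_(p <- form_rep w) p.1 * D p.2.

Lemma phi_funE (D : der_of lift_derivation) (s : seq (A * A)) :
  phi_fun D (\sum_(p <- s) p.1 *: d p.2) = \sum_(p <- s) p.1 * D p.2.
Proof.
have [_ D0] := der_mem D; set w := (X in phi_fun D X).
have := D0 (form_rep w ++ [seq (- p.1, p.2) | p <- s]).
rewrite !big_cat !big_map /= -form_repP.
under eq_bigr do rewrite scaleNr.
under [X in _ -> _ + X = 0]eq_bigr do rewrite mulNr.
by rewrite !sumrN subrr => /(_ erefl)/eqP; rewrite subr_eq0 => /eqP.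
Qed.

Lemma phi_fun_llinear D : llinear (phi_fun D).
Proof.
split=> [x y|a x].
  by rewrite {1}(form_repP x) {1}(form_repP y) -big_cat phi_funE big_cat.
rewrite {1}(form_repP x) scaler_sumr.
have := phi_funE D [seq (a * p.1, p.2) | p <- form_rep x].
rewrite !big_map /=; under eq_bigr do rewrite -scalerA.
by move=> ->; rewrite mulr_sumr; apply: eq_bigr => p _; rewrite mulrA.
Qed.

Lemma phi_fun_dd D a : phi_fun D (d a) = D a.
Proof.
have := phi_funE D [:: (1, a)].
by rewrite !big_seq1 /= scale1r mul1r.
Qed.

Lemma phi_fun_rlinear D : rlinear (phi_fun D).
Proof.
have [phiD phiZ] := phi_fun_llinear D.
split=> // x a.
have [[Dlin Dleib] _] := der_mem D.
have phi0 : phi_fun D 0 = 0.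
  by apply: (@addrI _ (phi_fun D 0)); rewrite -phiD !addr0.
have rs0 : (0 : Omega) :* a = 0.
  by apply: (@addrI _ ((0 : Omega) :* a)); rewrite -rscalerDl !addr0.
rewrite (form_repP x).
rewrite (big_morph (fun w => w :* a) (fun x y => rscalerDl x y a) rs0).
rewrite !(big_morph (phi_fun D) phiD phi0) mulr_suml.
apply: eq_bigr => p _.
have eN w : phi_fun D (- w) = - phi_fun D w.
  by apply/eqP; rewrite -addr_eq0 -phiD addNr phi0.
have -> : (p.1 *: d p.2) :* a = p.1 *: (d (p.2 * a) - p.2 *: d a).
  by rewrite dd_leibniz addrK bimodA.
by rewrite !phiZ phiD eN phiZ !phi_fun_dd Dleib addrK mulrA.
Qed.

Definition phi (D : der_of lift_derivation) : bvfield Omega :=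
  BVField (phi_fun_llinear D) (phi_fun_rlinear D).

End FirstOrder.

Section CentredCalculus.
Context (R : realType) (A : starAlgType R).

(* On a centred bimodule these conditions determine sigma; tau is its
   inverse. *)
Definition sigma_can (Omega : dagBimodType A)
    (sigma : tensor2 Omega -> tensor2 Omega) : Prop :=
  [/\ bimodule_map sigma,
      exists tau : tensor2 Omega -> tensor2 Omega,
        [/\ cancel sigma tau, cancel tau sigma &
            forall t, tau (dag t) = dag (sigma t)] &
      forall w h : Omega, central w \/ central h ->
        sigma (tens w h) = tens h w].

Definition Psi_of (Omega : dagBimodType A)
    (sigma : tensor2 Omega -> tensor2 Omega) (t : tensor2 Omega) :=
  cscal A 2^-1 *: (t + sigma t).

Record centredCalculus (Omega : dagBimodType A) := CentredCalculus {
  calc_fo :> hermFOStructure Omega;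
  sigma : tensor2 Omega -> tensor2 Omega;
  calc_centred : centred Omega;
  sigma_canonical : sigma_can sigma;
  metric_g_sigma : forall t, metric_g calc_fo (sigma t) = metric_g calc_fo t;
  calc_JT2 : forall s : seq (A * A), \sum_(p <- s) p.1 *: dd calc_fo p.2 = 0 ->
    exists t, Psi_of sigma t =
      \sum_(p <- s) tens (dd calc_fo p.1) (dd calc_fo p.2)
}.

Context (Omega : dagBimodType A) (K : centredCalculus Omega).
Local Notation d := (dd K).
Local Notation T2 := (tensor2 Omega).

Definition Psi : T2 -> T2 := Psi_of (sigma K).

(* Independent of the expression chosen for w, see [d_PsiE]. *)
Definition d_Psi (w : Omega) : T2 :=
  let t := \sum_(p <- form_rep K w) tens (d p.1) (d p.2) in t - Psi t.

Record rightConnection := RightConnection {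
  nabla :> Omega -> T2;
  nabla_linear : forall (c : R[i]) w h,
    nabla (cscal A c *: w + h) = cscal A c *: nabla w + nabla h;
  nabla_leibniz : forall w a, nabla (w :* a) = nabla w :* a + tens w (d a)
}.

Definition conj_left (nab : Omega -> T2) (w : Omega) : T2 :=
  - dag (nab (dag w)).

Definition torsion_free (nab : rightConnection) : Prop :=
  forall w, (nab w - Psi (nab w)) + d_Psi w = 0.

Definition hermitian_connection (nab : rightConnection) : Prop :=
  forall w h, - ip_tens_form K (nab w) h + ip_form_tens K w (nab h) =
    d (ip K w h).

Definition sigma_dag_bimodule_connection (nab : rightConnection) : Prop :=
  forall w, sigma K (nab w) = conj_left nab w.

Local Notation DC := (lift_derivation K).
Implicit Types (nab : rightConnection).

Definition phi_l (D : der_of DC) : lvfield Omega := lvfield_of (phi D).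
Definition phi_r (D : der_of DC) : rvfield Omega := rvfield_of (phi D).

Lemma tensD0l (w : Omega) : tens 0 w = 0.
Proof.
have [tD _ _] := @balanced_tens _ _ Omega.
by apply: (@addrI _ (tens 0 w)); rewrite -tD !addr0.
Qed.

Lemma sigmaK : involutive (sigma K).
Proof.
have [[sD sl sr] _ sflip] := sigma_canonical K.
have [tD _ tb] := @balanced_tens _ _ Omega.
have s0 : sigma K 0 = 0.
  by apply: (@addrI _ (sigma K 0)); rewrite -sD !addr0.
move=> t; have [s ->] := tens_sumE t.
rewrite !(big_morph (sigma K) sD s0); apply: eq_bigr => -[w h] _ /=.
have [r [rc ->]] := calc_centred K w.
rewrite (big_morph (fun x => tens x h) (fun x y => tD x y h) (tensD0l h)).
rewrite !(big_morph (sigma K) sD s0) !big_seq; apply: eq_bigr => p /rc cp.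
by rewrite tb -lscale_tens !sl !sflip//; [right | left].
Qed.

Lemma d_PsiE (s : seq (A * A)) :
  d_Psi (\sum_(p <- s) p.1 *: d p.2) =
  let t := \sum_(p <- s) tens (d p.1) (d p.2) in t - Psi t.
Proof.
have [[sD sl sr] _ _] := sigma_canonical K.
have s0 : sigma K 0 = 0.
  by apply: (@addrI _ (sigma K 0)); rewrite -sD !addr0.
have sN t : sigma K (- t) = - sigma K t.
  by apply/eqP; rewrite -addr_eq0 -sD addNr s0.
have PD t u : Psi (t - u) = Psi t - Psi u.
  by rewrite /Psi /Psi_of sD sN -scalerBr opprD addrACA.
have cc : cscal A 2^-1 + cscal A 2^-1 = 1.
  have h : (2^-1 + 2^-1 : R[i]) = 1.
    by rewrite -[2^-1]mul1r -mulrDl -[1 + 1]/2 divff// pnatr_eq0.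
  by rewrite /cscal -scalerDl h scale1r.
have sP t : sigma K (Psi t) = Psi t.
  by rewrite /Psi /Psi_of sl sD sigmaK addrC.
have PP t : Psi (Psi t) = Psi t.
  by rewrite {1}/Psi /Psi_of sP scalerDr -scalerDl cc scale1r.
rewrite /d_Psi; set w := (X in form_rep K X).
set s' := form_rep K w.
have e : \sum_(p <- s' ++ [seq (- p.1, p.2) | p <- s]) p.1 *: d p.2 = 0.
  rewrite big_cat big_map /= -form_repP; under eq_bigr do rewrite scaleNr.
  by rewrite sumrN subrr.
have [t] := calc_JT2 e; rewrite -/(Psi t) big_cat big_map /=.
have d0 : d 0 = 0.
  have := dd_linear K 1 0 0; rewrite /cscal !scale1r addr0.
  by move=> e1; apply: (@addrI _ (d 0)); rewrite addr0 -e1.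
have dN a : d (- a) = - d a.
  have := dd_linear K (-1) a 0.
  by rewrite /cscal !scaleN1r d0 !addr0.
have tN (x y : Omega) : tens (- x) y = - tens x y.
  exact: balancedNl (@balanced_tens _ _ Omega) _ _.
under [X in _ + X]eq_bigr do rewrite dN tN.
rewrite sumrN; set u := (X in X - _); set v := (X in _ - X) => ht.
apply/eqP; rewrite -subr_eq0; apply/eqP.
have -> : u - Psi u - (v - Psi v) = (u - v) - Psi (u - v).
  by rewrite PD !opprB addrACA [RHS]addrACA [- v + _]addrC.
by rewrite -ht PP subrr.
Qed.

Lemma pairingD (X : rvfield Omega) t u (Y : lvfield Omega) :
  pairing X (t + u) Y = pairing X t Y + pairing X u Y.
Proof. exact/tliftD/balanced_pairing. Qed.

Lemma pairing_tens (X : rvfield Omega) w h (Y : lvfield Omega) :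
  pairing X (tens w h) Y = X w * Y h.
Proof. exact: (tliftE _ _ (balanced_pairing X Y)). Qed.

Lemma pairing_lscale (Z : bvfield Omega) a t (Y : lvfield Omega) :
  pairing (rvfield_of Z) (a *: t) Y = a * pairing (rvfield_of Z) t Y.
Proof.
rewrite /pairing tlift_lscale; last exact: balanced_pairing.
rewrite /tlift mulr_sumr; apply: eq_bigr => p _.
by rewrite /= (bvfield_llinear Z).2 mulrA.
Qed.

Lemma pairing_rscale (X : rvfield Omega) t a (Z : bvfield Omega) :
  pairing X (t :* a) (lvfield_of Z) = pairing X t (lvfield_of Z) * a.
Proof.
rewrite /pairing tlift_rscale; last exact: balanced_pairing.
rewrite /tlift mulr_suml; apply: eq_bigr => p _.
by rewrite /= (bvfield_rlinear Z).2 mulrA.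
Qed.

Lemma derivationD (D : A -> A) a b : derivation D -> D (a + b) = D a + D b.
Proof. by case=> Dl _; have := Dl 1 a b; rewrite !scale1r. Qed.

Lemma nablaD nab w h : nab (w + h) = nab w + nab h.
Proof. by have := nabla_linear nab 1 w h; rewrite /cscal !scale1r. Qed.

Lemma conj_leftD nab w h :
  conj_left nab (w + h) = conj_left nab w + conj_left nab h.
Proof. by rewrite /conj_left dagD nablaD dagD opprD. Qed.

Lemma conj_left_leibniz nab a w :
  conj_left nab (a *: w) = a *: conj_left nab w + tens (d a) w.
Proof.
rewrite /conj_left dagMl nabla_leibniz dagD dagMr starK dag_tens dagK opprD.
rewrite scalerN dd_star.
have dagN x : dag (- x) = - dag x :> Omega.
  have d0 : dag 0 = 0 :> Omega.
    by apply: (@addrI _ (dag 0)); rewrite -dagD !addr0.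
  by apply/eqP; rewrite -addr_eq0 -dagD addNr d0.
by rewrite dagN dagK (balancedNl (@balanced_tens _ _ Omega)) opprK.
Qed.

Lemma affR_subproof nab (D : hder_of DC) (X : rvfield Omega) :
  rlinear (fun w => D (X w) - pairing X (nab w) (phi_l D)).
Proof.
have [XD XZ] := rvfield_linear X; have [Dder _] := der_mem D.
split=> [x y|x a].
  by rewrite XD nablaD pairingD derivationD// opprD addrACA.
rewrite XZ nabla_leibniz pairingD pairing_rscale pairing_tens Dder.2.
by rewrite /= phi_fun_dd opprD addrACA subrr addr0 mulrBl.
Qed.

Lemma affL_subproof nab (D : hder_of DC) (X : lvfield Omega) :
  llinear (fun w => D (X w) - pairing (phi_r D) (conj_left nab w) X).
Proof.
have [XD XZ] := lvfield_linear X; have [Dder _] := der_mem D.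
split=> [x y|a x].
  by rewrite XD conj_leftD pairingD derivationD// opprD addrACA.
rewrite XZ conj_left_leibniz pairingD pairing_lscale pairing_tens Dder.2.
rewrite [RHS]mulrBr /= phi_fun_dd [D a * X x + _]addrC opprD addrACA subrr.
by rewrite addr0.
Qed.

Definition affR nab (D : hder_of DC) (X : rvfield Omega) : rvfield Omega :=
  mk_rvfield (affR_subproof nab D X).

Definition affL nab (D : hder_of DC) (X : lvfield Omega) : lvfield Omega :=
  mk_lvfield (affL_subproof nab D X).

End CentredCalculus.

Section PseudoRiemannianCalculi.
Context (R : realType) (A : starAlgType R).

(* D, D1, D2 range over elements of g (or Hermitian elements of g); an equation
   such as D = c D1 + D2 in g is expressed by its values. *)
Record right_real_pseudo_riemannian_calculus (X : rmodType A) (ip : X -> X -> A)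
    (g : (A -> A) -> Prop) (phi : der_of g -> X)
    (nab : hder_of g -> X -> X) : Prop := RightCalculus {
  rc_ipDl : forall x y z, ip (x + y) z = ip x z + ip y z;
  rc_ipDr : forall x y z, ip x (y + z) = ip x y + ip x z;
  rc_ipM : forall x y a, ip x (y :* a) = ip x y * a;
  rc_ip_star : forall x y, star (ip x y) = ip y x;
  rc_ip_nondegenerate : forall x, (forall y, ip x y = 0) -> x = 0;
  rc_lie : lie_subalgebra g;
  rc_phi_linear : forall (c : R[i]) (D D1 D2 : der_of g),
    (forall a, D a = c *: D1 a + D2 a) ->
    phi D = phi D1 :* cscal A c + phi D2;
  rc_phi_gen : forall x, exists s : seq (hder_of g * A),
    x = \sum_(p <- s) phi p.1 :* p.2;
  rc_nab_add : forall D x y, nab D (x + y) = nab D x + nab D y;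
  rc_nab_linear : forall (r : R) (D D1 D2 : hder_of g) x,
    (forall a, D a = r%:C *: D1 a + D2 a) ->
    nab D x = nab D1 x :* cscal A r%:C + nab D2 x;
  rc_nab_leibniz : forall (D : hder_of g) x a,
    nab D (x :* a) = nab D x :* a + x :* D a;
  rc_real0 : forall D D' : hder_of g,
    star (ip (phi D) (phi D')) = ip (phi D) (phi D');
  rc_real1 : forall D D' E : hder_of g,
    star (ip (nab E (phi D)) (phi D')) = ip (nab E (phi D)) (phi D');
  rc_real2 : forall D D' E1 E2 : hder_of g,
    star (ip (nab E1 (nab E2 (phi D))) (phi D')) =
    ip (nab E1 (nab E2 (phi D))) (phi D');
  rc_metric : forall (D : hder_of g) x y,
    D (ip x y) = ip (nab D x) y + ip x (nab D y);
  rc_torsion : forall D1 D2 E : hder_of g,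
    (forall a, E a = lie_bracket D1 D2 a) ->
    nab D1 (phi D2) - nab D2 (phi D1) - phi E = 0
}.

Record left_real_pseudo_riemannian_calculus (X : lmodType A) (ip : X -> X -> A)
    (g : (A -> A) -> Prop) (phi : der_of g -> X)
    (nab : hder_of g -> X -> X) : Prop := LeftCalculus {
  lc_ipDl : forall x y z, ip (x + y) z = ip x z + ip y z;
  lc_ipDr : forall x y z, ip x (y + z) = ip x y + ip x z;
  lc_ipM : forall a x y, ip (a *: x) y = a * ip x y;
  lc_ip_star : forall x y, star (ip x y) = ip y x;
  lc_ip_nondegenerate : forall x, (forall y, ip x y = 0) -> x = 0;
  lc_lie : lie_subalgebra g;
  lc_phi_linear : forall (c : R[i]) (D D1 D2 : der_of g),
    (forall a, D a = c *: D1 a + D2 a) ->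
    phi D = cscal A c *: phi D1 + phi D2;
  lc_phi_gen : forall x, exists s : seq (A * hder_of g),
    x = \sum_(p <- s) p.1 *: phi p.2;
  lc_nab_add : forall D x y, nab D (x + y) = nab D x + nab D y;
  lc_nab_linear : forall (r : R) (D D1 D2 : hder_of g) x,
    (forall a, D a = r%:C *: D1 a + D2 a) ->
    nab D x = cscal A r%:C *: nab D1 x + nab D2 x;
  lc_nab_leibniz : forall (D : hder_of g) a x,
    nab D (a *: x) = a *: nab D x + D a *: x;
  lc_real0 : forall D D' : hder_of g,
    star (ip (phi D) (phi D')) = ip (phi D) (phi D');
  lc_real1 : forall D D' E : hder_of g,
    star (ip (nab E (phi D)) (phi D')) = ip (nab E (phi D)) (phi D');
  lc_real2 : forall D D' E1 E2 : hder_of g,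
    star (ip (nab E1 (nab E2 (phi D))) (phi D')) =
    ip (nab E1 (nab E2 (phi D))) (phi D');
  lc_metric : forall (D : hder_of g) x y,
    D (ip x y) = ip (nab D x) y + ip x (nab D y);
  lc_torsion : forall D1 D2 E : hder_of g,
    (forall a, E a = lie_bracket D1 D2 a) ->
    nab D1 (phi D2) - nab D2 (phi D1) - phi E = 0
}.

Definition right_strongly_nondegenerate (X : rmodType A) (ip : X -> X -> A) :=
  [/\ forall x, rlinear (ip x),
      forall x x', (forall y, ip x y = ip x' y) -> x = x' &
      forall f, rlinear f -> exists x, forall y, ip x y = f y].

Definition left_strongly_nondegenerate (X : lmodType A) (ip : X -> X -> A) :=
  [/\ forall y, llinear (ip^~ y),
      forall y y', (forall x, ip x y = ip x y') -> y = y' &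
      forall f, llinear f -> exists y, forall x, ip x y = f x].

End PseudoRiemannianCalculi.

(* Main.v *)
(* The map [conj_rvf], X |-> - (X o dag)^*, is an antilinear isometry from left
   to right vector fields which intertwines the two affine connections, so the
   left calculus is a transcription of the right one.  Its fixed points, the
   left vector fields that are bimodule maps and anticommute with the
   involutions, are exactly the phi(D) with D a Hermitian derivation; they
   correspond to the central one-forms z with z^dag = - z.  Because sigma turns
   the right connection into its conjugate, the affine connection preserves
   these fixed points, so every reality condition reduces to that of
   <phi D | phi D'>, which is the sigma-symmetry of the metric. *)

Require Import Defs.
From HB Require Import structures.
From mathcomp Require Import all_boot all_order all_algebra.
From mathcomp Require Import complex.
From mathcomp Require Import reals.

Set Implicit Arguments.
Unset Strict Implicit.
Unset Printing Implicit Defensive.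

Import GRing.Theory Num.Theory.
Local Open Scope ring_scope.
Local Open Scope complex_scope.

(** * Additive maps between abelian groups *)

Section Additivity.
Context (U V : zmodType) (f : U -> V).
Hypothesis fD : {morph f : x y / x + y}.

Lemma morphD0 : f 0 = 0.
Proof. by apply: (@addrI _ (f 0)); rewrite -fD !addr0. Qed.

Lemma morphDN x : f (- x) = - f x.
Proof. by apply/eqP; rewrite -addr_eq0 -fD addNr morphD0. Qed.

Lemma morphDB x y : f (x - y) = f x - f y.
Proof. by rewrite fD morphDN. Qed.

Lemma morphD_sum I (r : seq I) (F : I -> U) :
  f (\sum_(i <- r) F i) = \sum_(i <- r) f (F i).
Proof. exact: (big_morph f fD morphD0). Qed.

End Additivity.

(** * Scalars and derivations of the algebra *)

Section StarAlgebra.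
Context (R : realType) (A : starAlgType R).

Lemma starN (a : A) : star (- a) = - star a.
Proof. exact: (morphDN (@starD R A)). Qed.

Lemma cscalM (c : R[i]) (a : A) : cscal A c * a = c *: a.
Proof. by rewrite -scalerAl mul1r. Qed.

Lemma cscalC (c : R[i]) (a : A) : cscal A c * a = a * cscal A c.
Proof. by rewrite cscalM -scalerAr mulr1. Qed.

Lemma dagN (M : dagBimodType A) (x : M) : dag (- x) = - dag x.
Proof. exact: (morphDN (@dagD R A M)). Qed.

Lemma derivation0 : @derivation R A (fun=> 0).
Proof. by split=> *; rewrite ?scaler0 ?addr0 ?mul0r ?mulr0 ?addr0. Qed.

Lemma derivation_linear (c : R[i]) (D E : A -> A) :
  derivation D -> derivation E ->
  derivation (fun a => c *: D a + E a).
Proof.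
move=> [Dl DM] [El EM]; split=> [x a b|a b].
  by rewrite Dl El !scalerDr !scalerA [x * c]mulrC addrACA.
by rewrite DM EM scalerDr mulrDl mulrDr -scalerAl -scalerAr addrACA.
Qed.

(** In [D (E (a b))] the mixed terms [D a * E b + E a * D b] are symmetric in [D] and [E], so they
    cancel in the bracket. *)
Lemma derivation_bracket (D E : A -> A) : derivation D -> derivation E ->
  derivation (lie_bracket D E).
Proof.
move=> Dd Ed; have [Dl DM] := Dd; have [El EM] := Ed.
rewrite /lie_bracket; split=> [c a b|a b].
  by rewrite Dl El Dl El scalerBr opprD addrACA.
rewrite EM DM (derivationD _ _ Dd) (derivationD _ _ Ed) !DM !EM mulrBl mulrBr.
rewrite [D a * E b + _]addrC addrACA [E a * D b + a * _]addrC.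
rewrite [X in _ - X]addrACA [D a * E b + _]addrC -addrA.
by rewrite [X in _ - X]addrC -[LHS]addrA addrKA opprD [RHS]addrACA -addrA.
Qed.

End StarAlgebra.

(** * One-forms and the musical isomorphisms *)

Section FirstOrderStructure.
Context (R : realType) (A : starAlgType R) (Omega : dagBimodType A).
Context (K : hermFOStructure Omega).
Local Notation d := (dd K).
Local Notation DC := (lift_derivation K).

Lemma dd1 : d 1 = 0.
Proof.
have := dd_leibniz K 1 1.
rewrite mulr1 rscaler1 scale1r => /esym/eqP.
by rewrite -subr_eq0 addrK => /eqP.
Qed.

(** Exact forms generate [Omega] as a left module. *)
Lemma llinear_ext (f g : Omega -> A) : llinear f -> llinear g ->
  (forall a, f (d a) = g (d a)) -> f =1 g.
Proof.
move=> [fD fZ] [gD gZ] fg w; rewrite (form_repP K w) (morphD_sum fD) (morphD_sum gD).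
by apply: eq_bigr => p _; rewrite fZ gZ fg.
Qed.

(** Left linearity annihilates the relations between the [a db]; right linearity is what turns the
    term [da b] of the Leibniz rule into [X (d a) * b]. *)
Lemma lift_derivation_lvfield (X : lvfield Omega) : rlinear X ->
  DC (fun a => X (d a)).
Proof.
have [XD XZ] := lvfield_linear X; case=> _ Xr; split; first split=> [c a b|a b].
- by rewrite dd_linear XD XZ cscalM.
- by rewrite dd_leibniz XD XZ Xr.
move=> s s0; rewrite -[RHS](morphD0 XD) -[in RHS]s0 (morphD_sum XD).
by apply: eq_bigr => p _; rewrite XZ.
Qed.

Lemma flatLE (X : lvfield Omega) h : ip K (dag h) (flatL K X) = X h.
Proof. by rewrite -[in RHS](flatLK K X). Qed.

Lemma flatRE (U : rvfield Omega) h : ip K (dag (flatR K U)) h = U h.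
Proof. by rewrite -[in RHS](flatRK K U). Qed.

Lemma ip_lext w w' : (forall h, ip K h w = ip K h w') -> w = w'.
Proof.
move=> e; apply: (@sharpL_inj _ _ _ K); apply: lvfield_eq => h; exact: e.
Qed.

Lemma flatLD : {morph flatL K : X Y / X + Y}.
Proof.
move=> X Y; apply: ip_lext => h.
by rewrite ipDr -[h]dagK !flatLE lvfieldDE.
Qed.

Lemma flatLZ X a : flatL K (X :* a) = flatL K X :* a.
Proof.
by apply: ip_lext => h; rewrite ipMr -[h]dagK !flatLE lvfield_rscaleE.
Qed.

(** * Conjugation between left and right vector fields *)

Lemma conj_rvf_subproof (X : lvfield Omega) : rlinear (fun h => - star (X (dag h))).
Proof.
have [XD XZ] := lvfield_linear X; split=> [x y|x a].
  by rewrite dagD XD starD opprD.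
by rewrite dagMr XZ starM starK mulNr.
Qed.

Lemma conj_lvf_subproof (U : rvfield Omega) : llinear (fun h => - star (U (dag h))).
Proof.
have [UD UZ] := rvfield_linear U; split=> [x y|a x].
  by rewrite dagD UD starD opprD.
by rewrite dagMl UZ starM starK mulrN.
Qed.

(** The sign is the one in [dd_star]: it compensates the minus sign that [dag] produces on exact
    forms. *)
Definition conj_rvf (X : lvfield Omega) : rvfield Omega :=
  mk_rvfield (conj_rvf_subproof X).
Definition conj_lvf (U : rvfield Omega) : lvfield Omega :=
  mk_lvfield (conj_lvf_subproof U).

Lemma conj_rvfK : cancel conj_rvf conj_lvf.
Proof. by move=> X; apply: lvfield_eq => h /=; rewrite starN opprK starK dagK. Qed.

Lemma conj_lvfK : cancel conj_lvf conj_rvf.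
Proof. by move=> U; apply: rvfield_eq => h /=; rewrite starN opprK starK dagK. Qed.

Lemma conj_rvfD : {morph conj_rvf : X Y / X + Y}.
Proof.
by move=> X Y; apply: rvfield_eq => h; rewrite rvfieldDE /= -opprD -starD.
Qed.

Lemma conj_rvfZ (X : lvfield Omega) a : conj_rvf (X :* a) = star a *: conj_rvf X.
Proof. by apply: rvfield_eq => h; rewrite rvfield_lscaleE /= starM mulrN. Qed.

(** On one-forms, conjugation is minus [dag]. Since [ip_rvf] applies [dag] to both flats, only two
    signs remain, and they cancel. *)
Lemma ip_conj_rvf X Y : ip_rvf K (conj_rvf X) (conj_rvf Y) = ip_lvf K X Y.
Proof.
have e Z : dag (flatR K (conj_rvf Z)) = - flatL K Z.
  apply: (can_inj dagK); apply: (@ip_sharp_inj _ _ _ K) => h.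
  rewrite dagK flatRE dagK /= -flatLE dagK ip_star.
  by rewrite (morphDN (f := fun w => ip K w h)) // => x y; rewrite ipDl.
rewrite /ip_rvf /ip_lvf !e (morphDN (f := ip K _)); last exact: ipDr.
by rewrite -ip_star (morphDN (f := ip K _)) ?starN ?opprK ?ip_star//; exact: ipDr.
Qed.

(** * Fixed points of conjugation and Hermitian derivations *)

Definition hermitian_field (X : lvfield Omega) : Prop :=
  forall h, conj_rvf X h = X h.

(** The fixed-point condition equates a left field with a right field, hence contains the bimodule
    property. *)
Lemma hermitian_field_rlinear X : hermitian_field X -> rlinear X.
Proof.
move=> Xh; have [XD XZ] := rvfield_linear (conj_rvf X).
by split=> *; rewrite -!Xh.
Qed.

Lemma hermitian_field_dd (X : lvfield Omega) : hermitian_field X ->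
  hermitian_der (fun a => X (d a)).
Proof.
move=> Xh a; rewrite -[RHS]Xh /= dd_star.
by rewrite (morphDN (lvfield_linear X).1) starN.
Qed.

Lemma hermitian_field_phi X : hermitian_field X ->
  exists D : hder_of DC, lvfield_of (phi D) = X.
Proof.
move=> Xh; have Xd := lift_derivation_lvfield (hermitian_field_rlinear Xh).
exists (@HDerOf _ _ _ (DerOf Xd) (hermitian_field_dd Xh)).
apply: lvfield_eq; apply: llinear_ext; try exact: lvfield_linear.
by move=> a; rewrite /= phi_fun_dd.
Qed.

(** On a term [a db] this follows from [dag (a db) = - d (star b) star a], the right linearity of
    [phi D] and the Hermiticity of [D]. *)
Lemma phi_hermitian_field (D : hder_of DC) : hermitian_field (lvfield_of (phi D)).
Proof.
have [phiD phiZ] := phi_fun_llinear D; have [_ phiM] := phi_fun_rlinear D.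
move=> h; rewrite {2}(form_repP K h) {1}(form_repP K h) /=.
rewrite (morphD_sum (@dagD _ _ _)) !(morphD_sum phiD).
rewrite (morphD_sum (@starD _ _)) -sumrN; apply: eq_bigr => p _.
rewrite dagMl phiM phiZ starM starK -mulrN -[dag _]opprK -dd_star.
by rewrite (morphDN phiD) starN opprK !phi_fun_dd hder_herm.
Qed.

Lemma phi_fun_linear (c : R[i]) (D D1 D2 : der_of DC) w :
  (forall a, D a = c *: D1 a + D2 a) ->
  phi_fun D w = c *: phi_fun D1 w + phi_fun D2 w.
Proof.
(* All three sums run over the same chosen expression of [w], so they can be compared term by
   term. *)
move=> e; rewrite /phi_fun scaler_sumr -big_split; apply: eq_bigr => p _ /=.
by rewrite e mulrDr -scalerAr.
Qed.

End FirstOrderStructure.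

(** * Pairings with tensors and the symmetry [sigma] *)

Section CentredCalculusTheory.
Context (R : realType) (A : starAlgType R) (Omega : dagBimodType A).
Context (K : centredCalculus Omega).
Local Notation d := (dd K).
Local Notation DC := (lift_derivation K).
Local Notation T2 := (tensor2 Omega).
Implicit Types (nab : rightConnection K).

Lemma tensor2_additive_ext (V : zmodType) (f g : T2 -> V) :
  {morph f : t u / t + u} -> {morph g : t u / t + u} ->
  (forall w h, f (tens w h) = g (tens w h)) -> f =1 g.
Proof.
move=> fD gD fg t; have [s ->] := tens_sumE t.
by rewrite (morphD_sum fD) (morphD_sum gD); apply: eq_bigr.
Qed.

Lemma sigmaD : {morph sigma K : t u / t + u}.
Proof. by have [[]] := sigma_canonical K. Qed.

(** Centredness as an induction principle: an additive property of one-forms is checked on [a z b]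
    with [z] central, where the flip formula for [sigma] applies. *)
Lemma tens_ind_central (P : Omega -> Prop) :
  (forall x y, P x -> P y -> P (x + y)) -> P 0 ->
  (forall a z b, central z -> P (a *: z :* b)) -> forall w, P w.
Proof.
move=> PD P0 Pz w; have [s [sc ->]] := calc_centred K w.
rewrite big_seq; elim/big_ind: _ => // p /sc; exact: Pz.
Qed.

Lemma pairing0 (U : rvfield Omega) (V : lvfield Omega) : pairing U (0 : T2) V = 0.
Proof. exact: (morphD0 (fun t u => pairingD U t u V)). Qed.

Lemma pairing_sum (U : rvfield Omega) (V : lvfield Omega) I (r : seq I) (F : I -> T2) :
  pairing U (\sum_(i <- r) F i) V = \sum_(i <- r) pairing U (F i) V.
Proof. exact: (morphD_sum (fun t u => pairingD U t u V)). Qed.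

Lemma pairing_sigma (U V : bvfield Omega) t :
  pairing (rvfield_of U) (sigma K t) (lvfield_of V) =
  pairing (rvfield_of V) t (lvfield_of U).
Proof.
have [[_ sl _] _ sflip] := sigma_canonical K.
have [tDl tDr tb] := @balanced_tens _ _ Omega.
move: t; apply: tensor2_additive_ext => [t u|t u|w h].
- by rewrite sigmaD pairingD.
- by rewrite pairingD.
elim/tens_ind_central: w => [x y ex ey||a z b cz].
- by rewrite tDl sigmaD !pairingD ex ey.
- by rewrite tensD0l (morphD0 sigmaD) !pairing0.
rewrite tb -lscale_tens sl sflip; last by left.
rewrite !pairing_lscale !pairing_tens /=.
(* As [z] is central and [V] is a bimodule map, [V z] commutes with every element of the algebra. *)
by rewrite -(bvfield_rlinear V).2 -cz (bvfield_llinear V).2.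
Qed.

Lemma pairing_dag (U : rvfield Omega) t (V : lvfield Omega) :
  star (pairing U (dag t) V) = pairing (conj_rvf V) t (conj_lvf U).
Proof.
move: t; apply: tensor2_additive_ext => [t u|t u|w h].
- by rewrite dagD pairingD starD.
- by rewrite pairingD.
by rewrite dag_tens !pairing_tens starM /= mulrNN.
Qed.

(** This is the [sigma]-invariance of the metric on [w (x) z], where [sigma] is the flip. *)
Lemma ip_central_sym w z : central z -> ip K (dag w) z = ip K (dag z) w.
Proof.
move=> cz; have [_ _ sflip] := sigma_canonical K.
have := metric_g_sigma K (tens w z); rewrite sflip; last by right.
by rewrite /metric_g !tliftE; [move/oppr_inj | exact: balanced_metric_g..].
Qed.

(* If sum a_i db_i = 0 then, differentiating sum a_i E b_i = 0 along D and
   exchanging D and E, sum a_i [D, E] b_i is the antisymmetrized pairing of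
   sum da_i (x) db_i with phi D and phi E; it vanishes as JT2 lies in the image
   of Psi, whose elements are fixed by sigma. *)
Lemma lift_derivation_lie : lie_subalgebra DC.
Proof.
split=> [D []//||c D E [Dd D0] [Ed E0]|D E gD gE].
- by split; [exact: derivation0 | move=> s _; rewrite big1// => p _; rewrite mulr0].
- split; first exact: derivation_linear.
  move=> s s0; under eq_bigr do rewrite mulrDr -scalerAr.
  by rewrite big_split /= -scaler_sumr D0// E0// scaler0 addr0.
have [[Dd D0] [Ed E0]] := (gD, gE).
split; first exact: derivation_bracket.
move=> s s0; have [t tE] := calc_JT2 s0.
set U := phi (DerOf gD); set V := phi (DerOf gE).
have DD : {morph D : a b / a + b} by move=> a b; exact: derivationD.
have [_ DM] := Dd.
have ED : {morph E : a b / a + b} by move=> a b; exact: derivationD.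
have [_ EM] := Ed.
have DE : \sum_(p <- s) D p.1 * E p.2 = - \sum_(p <- s) p.1 * D (E p.2).
  apply/eqP; rewrite -addr_eq0 -big_split /=; apply/eqP.
  under eq_bigr do rewrite -DM.
  by rewrite -(morphD_sum DD) E0// (morphD0 DD).
have ED' : \sum_(p <- s) E p.1 * D p.2 = - \sum_(p <- s) p.1 * E (D p.2).
  apply/eqP; rewrite -addr_eq0 -big_split /=; apply/eqP.
  under eq_bigr do rewrite -EM.
  by rewrite -(morphD_sum ED) D0// (morphD0 ED).
have sPsi : sigma K (Psi_of (sigma K) t) = Psi_of (sigma K) t.
  have [[_ sl _] _ _] := sigma_canonical K.
  by rewrite /Psi_of sl sigmaD sigmaK addrC.
have := pairing_sigma U V (Psi_of (sigma K) t).
rewrite sPsi tE !pairing_sum.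
under eq_bigr do rewrite pairing_tens /= !phi_fun_dd.
under [X in _ = X -> _]eq_bigr do rewrite pairing_tens /= !phi_fun_dd.
rewrite /= DE ED' => /oppr_inj e.
under eq_bigr do rewrite mulrBr.
by rewrite sumrB e subrr.
Qed.

(** * Central one-forms and generation of the vector fields *)

Lemma central_scale (c : R[i]) (z : Omega) : central z -> central (cscal A c *: z).
Proof. by move=> cz a; rewrite bimodA scalerA -cz scalerA cscalC. Qed.

Lemma central_dag (z : Omega) : central z -> central (dag z).
Proof. by move=> cz a; rewrite -[a]starK -dagMr -cz dagMl. Qed.

Lemma centralB (x y : Omega) : central x -> central y -> central (x - y).
Proof.
move=> cx cy a; rewrite scalerBr cx cy.
by rewrite (morphDB (f := fun w => w :* a)) // => u v; rewrite rscalerDl.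
Qed.

Lemma hermitian_field_sharpL z : central z -> dag z = - z ->
  hermitian_field (sharpL K z).
Proof.
move=> cz zN h /=; rewrite dagK ip_star (ip_central_sym _ cz) zN.
by rewrite (morphDN (f := fun w => ip K w h)) // => x y; rewrite ipDl.
Qed.

(** Decomposition into real and imaginary parts for the conjugation [z |-> - dag z]:
    [x = (z - dag z)/2] and [y = -i (z + dag z)/2]. *)
Lemma central_split (z : Omega) : central z -> exists x y : Omega,
  [/\ central x, central y, dag x = - x, dag y = - y &
      z = x + cscal A 'i *: y].
Proof.
move=> cz; have cd := central_dag cz.
have cD : central (z + dag z).
  have -> : z + dag z = z - - dag z by rewrite opprK.
  apply: centralB => // a; rewrite scalerN cd.
  by rewrite (morphDN (f := fun w => w :* a)) // => u v; rewrite rscalerDl.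
have h2 : (2^-1 : R[i])^* = 2^-1 by rewrite conjc_inv conjc_nat.
have ii : (- 'i * 2^-1 : R[i])^* = 'i * 2^-1.
  rewrite rmorphM; congr (_ * _); last exact: h2.
  by apply/eqP; rewrite eq_complex /= oppr0 opprK !eqxx.
exists (cscal A 2^-1 *: (z - dag z)), (cscal A (- 'i * 2^-1) *: (z + dag z)).
split.
- exact/central_scale/centralB.
- exact: central_scale.
- by rewrite dagZ h2 dagD dagN dagK -scalerN opprB addrC.
- rewrite dagZ ii dagD dagK [dag z + z]addrC.
  by rewrite /cscal mulNr !scaleNr opprK.
rewrite [X in _ + X]scalerA cscalM /cscal [X in _ + X *: _]scalerA.
have -> : ('i * (- 'i * 2^-1) : R[i]) = 2^-1.
  by rewrite mulrA mulrN -expr2 sqr_i opprK mul1r.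
rewrite -scalerDr addrACA [- _ + _]addrC subrr addr0 scalerDr -!scalerDl.
have -> : (2^-1 + 2^-1 : R[i]) = 1.
  by rewrite -[2^-1]mul1r -mulrDl -[1 + 1]/2 divff// pnatr_eq0.
by rewrite !scale1r.
Qed.

(** The flat of [X] is a sum of terms [a z b] with [z] central; each half of [z] given by
    [central_split] has a Hermitian field as its sharp, hence some [phi_l D]. *)
Lemma phi_l_generate (X : lvfield Omega) : exists s : seq (hder_of DC * A),
  X = \sum_(p <- s) phi_l p.1 :* p.2.
Proof.
rewrite -[X](flatLK K).
have gen_herm z : central z -> dag z = - z ->
    exists D : hder_of DC, sharpL K z = phi_l D.
  move=> cz zN; have [D DE] := hermitian_field_phi K (hermitian_field_sharpL cz zN).
  by exists D.
have sharpD x y : sharpL K (x + y) = sharpL K x + sharpL K y.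
  by apply: lvfield_eq => h; rewrite lvfieldDE /= ipDr.
have sharpM x a : sharpL K (x :* a) = sharpL K x :* a.
  by apply: lvfield_eq => h; rewrite lvfield_rscaleE /= ipMr.
elim/tens_ind_central: (flatL K X) => [x y [s es] [t et]||a z b cz].
- by exists (s ++ t); rewrite sharpD es et big_cat.
- by exists [::]; rewrite big_nil (morphD0 sharpD).
have [x [y [cx cy /(gen_herm _ cx)[D DE] /(gen_herm _ cy)[E EE] ->]]] := central_split cz.
(* Centrality moves [a] to the right: [a (x + i y) b = x (a b) + y (i a b)]. *)
exists [:: (D, a * b); (E, cscal A 'i * (a * b))]; rewrite big_cons big_seq1 /=.
rewrite -DE -EE -!sharpM -sharpD; congr (sharpL K _).
by rewrite scalerDr rscalerDl bimodC cx rscaleA -bimodA cy !rscaleA cscalC mulrA -cscalC.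
Qed.

(** * Conjugation, metric compatibility and torsion of the affine connection *)

Lemma pairingN (U : rvfield Omega) t (V : lvfield Omega) :
  pairing U (- t) V = - pairing U t V.
Proof. exact: (morphDN (fun t u => pairingD U t u V)). Qed.

Lemma star_hder (D : hder_of DC) a : star (D a) = D (star a).
Proof. by rewrite -[RHS]hder_herm starK. Qed.

Lemma hderD (D : hder_of DC) : {morph D : a b / a + b}.
Proof. by have [? _] := der_mem D; move=> a b; exact: derivationD. Qed.

Lemma conj_rvf_phi (D : hder_of DC) : conj_rvf (phi_l D) = phi_r D.
Proof. by apply: rvfield_eq => h; rewrite phi_hermitian_field. Qed.

Lemma conj_rvf_affL nab (D : hder_of DC) (X : lvfield Omega) :
  conj_rvf (affL nab D X) = affR nab D (conj_rvf X).
Proof.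
apply: rvfield_eq => h /=; rewrite (morphDN (hderD D)) -star_hder.
rewrite /conj_left dagK pairingN opprK starD opprD pairing_dag.
by rewrite -(conj_rvf_phi D) conj_rvfK.
Qed.

(** Conjugating the left side gives [affR nab E (phi_r D)]. Its correction term agrees with that of
    [affL] by [pairing_sigma], because [sigma] carries [nab] to [conj_left nab]. Iterating the lemma
    handles second covariant derivatives. *)
Lemma affL_phi nab (D E : hder_of DC) :
  sigma_dag_bimodule_connection nab ->
  exists F : hder_of DC, affL nab E (phi_l D) = phi_l F.
Proof.
move=> sn; have [|F FE] := @hermitian_field_phi _ _ _ K (affL nab E (phi_l D)).
  move=> h; rewrite conj_rvf_affL conj_rvf_phi /= -sn.
  by congr (_ - _); exact/esym/(pairing_sigma (phi E) (phi D)).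
by exists F.
Qed.

(** Evaluated by [phi D], the first term of the Hermitian condition becomes the correction term of
    [affL]. *)
Lemma phi_ip_tens_form (D : der_of DC) t (X : lvfield Omega) :
  phi_fun D (ip_tens_form K t (flatL K X)) = pairing (phi_r D) (dag t) X.
Proof.
have [phiD _] := phi_fun_llinear D; have [_ phiM] := phi_fun_rlinear D.
have b := balanced_ip_tens_form K (flatL K X).
move: t; apply: tensor2_additive_ext => [t u|t u|w h].
- by rewrite /ip_tens_form tliftD.
- by rewrite dagD pairingD.
by rewrite /ip_tens_form tliftE // dag_tens pairing_tens phiM -(@flatLE _ _ _ K) dagK.
Qed.

Lemma dag_ip_form_tens w t : dag (ip_form_tens K w t) = ip_tens_form K t w.
Proof.
have bl := balanced_ip_form_tens K w; have br := balanced_ip_tens_form K w.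
move: t; apply: tensor2_additive_ext => [t u|t u|x y].
- by rewrite /ip_form_tens tliftD// dagD.
- by rewrite /ip_tens_form tliftD.
by rewrite /ip_form_tens /ip_tens_form !tliftE // dagMl ip_star.
Qed.

(** Through the flat, [affL nab D] becomes the contraction of [nab] with [phi D]: the Hermitian
    condition splits [D <w | flat X>] into this contraction and the term that [affL] subtracts. *)
Lemma ip_flatL_affL nab (D : hder_of DC) w (X : lvfield Omega) :
  hermitian_connection nab ->
  ip K w (flatL K (affL nab D X)) = phi_fun D (ip_form_tens K w (nab (flatL K X))).
Proof.
move=> hn; have [phiD _] := phi_fun_llinear D.
rewrite -{1}[w]dagK flatLE /= -(@flatLE _ _ _ K) dagK -(@phi_fun_dd _ _ _ K D) -hn.
rewrite phiD (morphDN phiD) phi_ip_tens_form /conj_left dagK pairingN opprK.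
by rewrite addrAC addNr add0r.
Qed.

Lemma affL_metric nab (D : hder_of DC) (X Y : lvfield Omega) :
  hermitian_connection nab ->
  D (ip_lvf K X Y) = ip_lvf K (affL nab D X) Y + ip_lvf K X (affL nab D Y).
Proof.
move=> hn; have [phiD _] := phi_fun_llinear D.
rewrite /ip_lvf ip_flatL_affL// -[ip K (flatL K (affL _ _ _)) _]ip_star ip_flatL_affL//.
rewrite -(@phi_fun_dd _ _ _ K D) -hn phiD (morphDN phiD) -dag_ip_form_tens.
congr (_ + _).
(* The two slots differ by [dag] inside and [star] outside, which [phi D] exchanges up to sign. *)
by rewrite -[phi_fun D (ip_form_tens _ _ _)](phi_hermitian_field D) /= starN starK.
Qed.

(** Writing [da] as [1 da] gives [d_Psi (d a) = 0], as [d 1 = 0]. Vanishing torsion then puts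
    [nab (d a)] in the image of [Psi], which [sigma] fixes. *)
Lemma nabla_dd_sym nab a : torsion_free nab -> sigma K (nab (d a)) = nab (d a).
Proof.
move=> tf; have [[_ sl _] _ _] := sigma_canonical K.
have := tf (d a); have := d_PsiE K [:: (1, a)].
rewrite !big_seq1 /= scale1r dd1 tensD0l => ->.
have P0 : Psi K 0 = 0 by rewrite /Psi /Psi_of (morphD0 sigmaD) addr0 scaler0.
rewrite P0 subrr addr0 => /eqP; rewrite subr_eq0 => /eqP e.
by rewrite e /Psi /Psi_of sl sigmaD sigmaK addrC.
Qed.

Lemma affL_torsion nab (D E F : hder_of DC) :
  torsion_free nab -> sigma_dag_bimodule_connection nab ->
  (forall a, F a = lie_bracket D E a) ->
  affL nab D (phi_l E) - affL nab E (phi_l D) - phi_l F = 0.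
Proof.
move=> tf sn FE; apply/eqP; rewrite subr_eq0 subr_eq; apply/eqP.
apply: lvfield_eq; apply: (@llinear_ext _ _ _ K); try exact: lvfield_linear.
move=> a; rewrite lvfieldDE /=  -!sn !phi_fun_dd FE /lie_bracket.
rewrite nabla_dd_sym// -{1}(nabla_dd_sym a tf).
rewrite (pairing_sigma (phi D) (phi E)).
by rewrite addrA subrK.
Qed.

(** * Reality of the inner products *)

Lemma ip_lvf_star (X Y : lvfield Omega) : star (ip_lvf K X Y) = ip_lvf K Y X.
Proof. exact: ip_star. Qed.

Lemma central_flatL (X : lvfield Omega) : rlinear X -> central (flatL K X).
Proof.
case=> _ Xr a; apply: (@ip_lext _ _ _ K) => h.
rewrite ipMr -[h in RHS]dagK flatLE -Xr -[h in LHS]dagK -[a]starK -ipMl.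
by rewrite -dagMr flatLE starK.
Qed.

Lemma dag_flatL (X : lvfield Omega) : hermitian_field X ->
  dag (flatL K X) = - flatL K X.
Proof.
move=> Xh; have cX := central_flatL (hermitian_field_rlinear Xh).
apply: (@ip_lext _ _ _ K) => h; rewrite (morphDN (f := ip K h)); last exact: ipDr.
rewrite -{1}[h]dagK (ip_central_sym _ (central_dag cX)) dagK -{2}[h]dagK flatLE.
by rewrite -[X _]Xh /= dagK -(@flatLE _ _ _ K) ip_star opprK.
Qed.

(** For the flats [x] of [phi_l D] and [y] of [phi_l E], both central and anti-self-adjoint, [<y |
    x> = <dag x | dag y> = <- x | - y> = <x | y>]. *)
Lemma ip_phi_real (D E : hder_of DC) :
  star (ip_lvf K (phi_l D) (phi_l E)) = ip_lvf K (phi_l D) (phi_l E).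
Proof.
have hD := phi_hermitian_field D; have hE := phi_hermitian_field E.
rewrite ip_lvf_star /ip_lvf -{1}[flatL K (phi_l E)]dagK.
rewrite ip_central_sym; last exact/central_flatL/hermitian_field_rlinear.
rewrite !dag_flatL// (morphDN (f := ip K _)); last exact: ipDr.
by rewrite -ip_star (morphDN (f := ip K _)) ?starN ?opprK ?ip_star//; exact: ipDr.
Qed.

(** * Linearity and Leibniz rules *)

Lemma affL_rscale nab (D : hder_of DC) (X : lvfield Omega) a :
  affL nab D (X :* a) = affL nab D X :* a + X :* D a.
Proof.
have [[_ DM] _] := der_mem D.
apply: lvfield_eq => h; rewrite lvfieldDE !lvfield_rscaleE /= DM.
rewrite mulrBl addrAC; congr (_ - _ + _).
move: (conj_left nab h); apply: tensor2_additive_ext => [t u|t u|x y].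
- by rewrite pairingD.
- by rewrite pairingD mulrDl.
by rewrite !pairing_tens lvfield_rscaleE mulrA.
Qed.

Lemma affLD nab (D : hder_of DC) : {morph affL nab D : X Y / X + Y}.
Proof.
move=> X Y; apply: lvfield_eq => h; rewrite lvfieldDE /= hderD.
rewrite addrACA -opprD; congr (_ - _).
move: (conj_left nab h); apply: tensor2_additive_ext => [t u|t u|x y].
- by rewrite pairingD.
- by rewrite !pairingD addrACA.
by rewrite !pairing_tens lvfieldDE mulrDr.
Qed.

Lemma affL_linear nab (r : R) (D D1 D2 : hder_of DC) X :
  (forall a, D a = r%:C *: D1 a + D2 a) ->
  affL nab D X = affL nab D1 X :* cscal A r%:C + affL nab D2 X.
Proof.
move=> e; apply: lvfield_eq => h; rewrite lvfieldDE lvfield_rscaleE /= e.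
rewrite -cscalC cscalM scalerBr addrACA -opprD; congr (_ - _).
move: (conj_left nab h); apply: tensor2_additive_ext => [t u|t u|x y].
- by rewrite pairingD.
- by rewrite !pairingD scalerDr addrACA.
by rewrite !pairing_tens /= (phi_fun_linear _ e) mulrDl scalerAl.
Qed.

Lemma phi_l_linear (c : R[i]) (D D1 D2 : der_of DC) :
  (forall a, D a = c *: D1 a + D2 a) ->
  phi_l D = phi_l D1 :* cscal A c + phi_l D2.
Proof.
move=> e; apply: lvfield_eq => h; rewrite lvfieldDE lvfield_rscaleE /=.
by rewrite -cscalC cscalM -(phi_fun_linear _ e).
Qed.

Lemma phi_r_linear (c : R[i]) (D D1 D2 : der_of DC) :
  (forall a, D a = c *: D1 a + D2 a) ->
  phi_r D = cscal A c *: phi_r D1 + phi_r D2.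
Proof.
move=> e; apply: rvfield_eq => h; rewrite rvfieldDE rvfield_lscaleE /=.
by rewrite cscalM -(phi_fun_linear _ e).
Qed.

(** * Strong non-degeneracy and the right calculus *)

Lemma ip_lvf_strongly_nondegenerate : right_strongly_nondegenerate (ip_lvf K).
Proof.
split=> [X|X Y XY|f [fD fM]].
- by split=> [Y Z|Y a]; rewrite /ip_lvf ?flatLD ?flatLZ ?ipDr ?ipMr.
- apply: (can_inj (flatLK K)); apply: (@ip_lext _ _ _ K) => h.
  rewrite -ip_star -[RHS]ip_star; congr star.
  by rewrite -[h](sharpLK K); exact: XY.
(* Precomposition with [sharpL] yields a functional on one-forms, which [ip_sharp_surj] represents
   as [<dag w | .>]; hence the witness built from [dag w]. *)
have fl : rlinear (fun h => f (sharpL K h)).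
  split=> [x y|x a]; rewrite -?fD -?fM; congr f; apply: lvfield_eq => h.
    by rewrite lvfieldDE /= ipDr.
  by rewrite lvfield_rscaleE /= ipMr.
have [w wE] := @ip_sharp_surj _ _ _ K _ fl.
by exists (sharpL K (dag w)) => Y; rewrite /ip_lvf sharpLK wE flatLK.
Qed.

Lemma right_calculus nab : hermitian_connection nab -> torsion_free nab ->
  sigma_dag_bimodule_connection nab ->
  right_real_pseudo_riemannian_calculus (ip_lvf K) (@phi_l R A Omega K) (affL nab).
Proof.
move=> hn tf sn.
have real1 (D D' E : hder_of DC) :
    star (ip_lvf K (affL nab E (phi_l D)) (phi_l D')) =
    ip_lvf K (affL nab E (phi_l D)) (phi_l D').
  by have [F ->] := affL_phi D E sn; exact: ip_phi_real.
split=> //.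
- by move=> X Y Z; rewrite /ip_lvf flatLD ipDl.
- by move=> X Y Z; rewrite /ip_lvf flatLD ipDr.
- by move=> X Y a; rewrite /ip_lvf flatLZ ipMr.
- exact: ip_lvf_star.
- move=> X X0; have [_ inj _] := ip_lvf_strongly_nondegenerate; apply: inj => Y.
  by rewrite X0 (morphD0 (f := fun X => ip_lvf K X Y)) // => U V;
    rewrite /ip_lvf flatLD ipDl.
- exact: lift_derivation_lie.
- exact: phi_l_linear.
- exact: phi_l_generate.
- exact: affLD.
- exact: affL_linear.
- exact: affL_rscale.
- exact: ip_phi_real.
- by move=> D D' E F; have [G ->] := affL_phi D F sn; exact: real1.
- by move=> D X Y; exact: affL_metric.
- by move=> D E F; exact: affL_torsion.
Qed.

(** * Transport to right vector fields and the left calculus *)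

Lemma conj_rvf_surj (U : rvfield Omega) : exists X, U = conj_rvf X.
Proof. by exists (conj_lvf U); rewrite conj_lvfK. Qed.

Lemma scale_conj_rvf a (X : lvfield Omega) : a *: conj_rvf X = conj_rvf (X :* star a).
Proof. by rewrite conj_rvfZ starK. Qed.

Lemma ip_rvf_strongly_nondegenerate : left_strongly_nondegenerate (ip_rvf K).
Proof.
have [lin inj surj] := ip_lvf_strongly_nondegenerate.
split=> [V|U V UV|f [fD fZ]].
- have [X ->] := conj_rvf_surj V; have [XD XM] := lin X.
  split=> [U U'|a U]; have [Y ->] := conj_rvf_surj U; last first.
    by rewrite scale_conj_rvf !ip_conj_rvf -!(ip_lvf_star X) XM starM starK.
  have [Y' ->] := conj_rvf_surj U'.
  by rewrite -conj_rvfD !ip_conj_rvf -!(ip_lvf_star X) XD starD.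
- move: U V UV => U V; have [X ->] := conj_rvf_surj U; have [Y ->] := conj_rvf_surj V.
  move=> XY; congr conj_rvf; apply: inj => Z.
  by rewrite -ip_lvf_star -[RHS]ip_lvf_star -!ip_conj_rvf XY.
(* Conjugation is antilinear, so the outer [star] is needed to obtain a right-linear functional from
   the left-linear [f]. *)
have [X XE] : exists X, forall Y, ip_lvf K X Y = star (f (conj_rvf Y)).
  apply: surj; split=> [X Y|X a]; first by rewrite conj_rvfD fD starD.
  by rewrite conj_rvfZ fZ starM starK.
exists (conj_rvf X) => U; have [Y ->] := conj_rvf_surj U.
by rewrite ip_conj_rvf -ip_lvf_star XE starK.
Qed.

Lemma left_calculus nab : hermitian_connection nab -> torsion_free nab ->
  sigma_dag_bimodule_connection nab ->
  left_real_pseudo_riemannian_calculus (ip_rvf K) (@phi_r R A Omega K) (affR nab).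
Proof.
move=> hn tf sn; have rc := right_calculus hn tf sn.
split=> [U V W|U V W|a U V|U V|U U0||c D D1 D2|U|D U V|r D D1 D2 U|D a U|D D'
        |D D' E|D D' E F|D U V|D E F FE].
- have [X ->] := conj_rvf_surj U; have [Y ->] := conj_rvf_surj V; have [Z ->] := conj_rvf_surj W.
  by rewrite -conj_rvfD !ip_conj_rvf (rc_ipDl rc).
- have [X ->] := conj_rvf_surj U; have [Y ->] := conj_rvf_surj V; have [Z ->] := conj_rvf_surj W.
  by rewrite -conj_rvfD !ip_conj_rvf (rc_ipDr rc).
- by have [lin _ _] := ip_rvf_strongly_nondegenerate; rewrite (lin V).2.
- have [X ->] := conj_rvf_surj U; have [Y ->] := conj_rvf_surj V.
  by rewrite !ip_conj_rvf (rc_ip_star rc).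
- move: U0; have [X ->] := conj_rvf_surj U => X0.
  rewrite (rc_ip_nondegenerate rc (x := X)) ?(morphD0 (@conj_rvfD _ _ _))// => Y.
  by rewrite -ip_conj_rvf.
- exact: lift_derivation_lie.
- exact: phi_r_linear.
- have [X ->] := conj_rvf_surj U; have [s ->] := phi_l_generate X.
  exists [seq (star p.2, p.1) | p <- s]; rewrite big_map (morphD_sum (@conj_rvfD _ _ _)).
  by apply: eq_bigr => p _; rewrite conj_rvfZ conj_rvf_phi.
- have [X ->] := conj_rvf_surj U; have [Y ->] := conj_rvf_surj V.
  by rewrite -conj_rvfD -!conj_rvf_affL affLD conj_rvfD.
- move=> e; have [X ->] := conj_rvf_surj U.
  rewrite -!conj_rvf_affL (affL_linear _ _ e) conj_rvfD conj_rvfZ.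
  (* Conjugation applies [star] to the coefficient, and a real scalar is unchanged. *)
  by rewrite star_cscal conjc_real.
- have [X ->] := conj_rvf_surj U.
  by rewrite !scale_conj_rvf -!conj_rvf_affL affL_rscale conj_rvfD !conj_rvfZ star_hder !starK.
- by rewrite -!conj_rvf_phi ip_conj_rvf (rc_real0 rc).
- by rewrite -!conj_rvf_phi -conj_rvf_affL ip_conj_rvf (rc_real1 rc).
- by rewrite -!conj_rvf_phi -!conj_rvf_affL ip_conj_rvf (rc_real2 rc).
- have [X ->] := conj_rvf_surj U; have [Y ->] := conj_rvf_surj V.
  by rewrite -!conj_rvf_affL !ip_conj_rvf (rc_metric rc).
rewrite -!conj_rvf_phi -!conj_rvf_affL -!(morphDB (@conj_rvfD _ _ _)).
by rewrite (rc_torsion rc FE) (morphD0 (@conj_rvfD _ _ _)).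
Qed.

End CentredCalculusTheory.

Theorem theorem4p20 (R : realType) (A : starAlgType R)
    (Omega : dagBimodType A) (K : centredCalculus Omega)
    (nab : rightConnection K) :
  hermitian_connection nab ->
  torsion_free nab ->
  sigma_dag_bimodule_connection nab ->
  [/\ right_real_pseudo_riemannian_calculus (ip_lvf K)
        (@phi_l R A Omega K) (affL nab),
      left_real_pseudo_riemannian_calculus (ip_rvf K)
        (@phi_r R A Omega K) (affR nab),
      right_strongly_nondegenerate (ip_lvf K) &
      left_strongly_nondegenerate (ip_rvf K)].
Proof.
move=> hn tf sn; split.
- exact: right_calculus.
- exact: left_calculus.
- exact: ip_lvf_strongly_nondegenerate.
- exact: ip_rvf_strongly_nondegenerate.
Qed.
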